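(* Let $K$ be a field of positive characteristic, $S=K[x_1,\ldots,x_n]$, and let $g,h\in S$ be square-free supported homogeneous polynomials with $\deg(h)=1+\deg(g)$. If $g$ is irreducible and does not divide $h$, then for every $a_1,\ldots,a_n\in K$ the quotient $S/\bigl(g(1+a_1x_1+\cdots+a_nx_n)+h\bigr)$ is F-rational.
   Context: A polynomial in $K[x_1,\ldots,x_n]$ is square-free supported if every monomial appearing in it with non-zero coefficient is square-free (equivalently, it has degree at most one in each variable). Homogeneous means with respect to the standard grading. A Noetherian ring $R$ of prime characteristic $p$ is F-rational if every parameter ideal of $R$ is tightly closed. An ideal $I=(r_1,\ldots,r_m)$ of $R$ is a parameter ideal if for every prime ideal $\mathfrak p\supseteq I$ the images of $r_1,\ldots,r_m$ in $R_{\mathfrak p}$ form part of a system of parameters of $R_{\mathfrak p}$. An ideal $I$ is tightly closed if $I=I^*$, where $I^*$ is the set of $r\in R$ for which there is $c\in R$ not in any minimal prime of $R$ with $cr^{p^e}\in I^{[p^e]}$ for all $e\gg 0$; here $I^{[p^e]}$ is the ideal generated by the $p^e$-th powers of elements of $I$. *)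

(* Defs.v *)
From HB Require Import structures.
From mathcomp Require Import all_boot all_order all_algebra.
From mathcomp Require Import boolp classical_sets.
From mathcomp Require Import mpoly.
From mathcomp Require Import ring.

Set Implicit Arguments.
Unset Strict Implicit.
Unset Printing Implicit Defensive.

Import GRing.Theory.
Local Open Scope ring_scope.
Local Open Scope quotient_scope.
Local Open Scope classical_set_scope.

Section Ideals.
Variable R : comPzRingType.
Implicit Types (I J P Q m : set R) (A : set R) (r : seq R).

Definition ideal I : Prop :=
  [/\ I 0, forall x y, I x -> I y -> I (x + y)
    & forall a x, I x -> I (a * x)].

Definition generated_ideal A : set R :=
  [set x | forall J, ideal J -> A `<=` J -> J x].

Lemma generated_idealP A : ideal (generated_ideal A).
Proof.
split=> [J [] // |x y Ix Iy J idJ sAJ|a x Ix J idJ sAJ].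
  by have [_ + _] := idJ; apply; [apply: Ix|apply: Iy].
by have [_ _] := idJ; apply; apply: Ix.
Qed.

Definition prime_ideal P : Prop :=
  [/\ ideal P, ~ P 1 & forall x y, P (x * y) -> P x \/ P y].

Definition maximal_ideal m : Prop :=
  [/\ ideal m, ~ m 1
    & forall J, ideal J -> ~ J 1 -> m `<=` J -> J = m].

Definition minimal_prime P : Prop :=
  prime_ideal P /\ forall Q, prime_ideal Q -> Q `<=` P -> Q = P.

Definition radical I : set R := [set x | exists k : nat, I (x ^+ k)].

Definition noetherian : Prop :=
  forall I, ideal I -> exists r, I = generated_ideal [set` r].

Definition has_prime_chain (d : nat) : Prop :=
  exists c : nat -> set R,
    (forall i, (i <= d)%N -> prime_ideal (c i)) /\
    (forall i, (i < d)%N -> c i `<` c i.+1).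

Definition has_krull_dim (d : nat) : Prop :=
  has_prime_chain d /\ forall e, has_prime_chain e -> (e <= d)%N.

Definition local_with m : Prop :=
  maximal_ideal m /\ forall m', maximal_ideal m' -> m' = m.

(* Implies that the ring is local and that all entries of r lie in its maximal
   ideal m. *)
Definition system_of_parameters r : Prop :=
  exists m, [/\ local_with m, has_krull_dim (size r)
              & radical (generated_ideal [set` r]) = m].

Definition part_of_system_of_parameters r : Prop :=
  exists s, system_of_parameters (r ++ s).

(* Unlike [p \in [pchar R]], this excludes the zero ring. *)
Definition has_prime_char (p : nat) : Prop :=
  prime p /\ forall k : nat, k%:R = 0 :> R <-> (p %| k)%N.

Definition frobenius_power I (q : nat) : set R :=
  generated_ideal [set x ^+ q | x in I].

Definition tight_closure (p : nat) I : set R :=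
  [set r | exists c, (forall P, minimal_prime P -> ~ P c) /\
     exists e0 : nat, forall e : nat, (e0 <= e)%N ->
       frobenius_power I (p ^ e) (c * r ^+ (p ^ e))].

Definition tightly_closed (p : nat) I : Prop := I = tight_closure p I.

End Ideals.

Arguments noetherian : clear implicits.
Arguments has_prime_chain : clear implicits.
Arguments has_krull_dim : clear implicits.
Arguments has_prime_char : clear implicits.

(* The quotient ring R / I.  The library's ring structure on
   [{ideal_quot I}] is restricted to proper ideals; its Z-module structure is
   not, so it is the starting point here. *)
Section Quotient.
Variables (R : comPzRingType) (I : set R) (idI : ideal I).

Definition ideal_pred of ideal I : {pred R} := fun x => `[< I x >].
Local Notation Ip := (ideal_pred idI).

Lemma ideal_predE x : (x \in Ip) = `[< I x >]. Proof. by []. Qed.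

Lemma ideal_pred_closed : zmod_closed Ip.
Proof.
have [I0 ID IM] := idI; split=> [|x y]; rewrite !ideal_predE; first exact/asboolP.
by move=> /asboolP Ix /asboolP Iy; apply/asboolP/ID; rewrite // -mulN1r; apply: IM.
Qed.

HB.instance Definition _ := GRing.isZmodClosed.Build R Ip ideal_pred_closed.

Lemma ideal_predM a x : x \in Ip -> a * x \in Ip.
Proof.
by have [_ _ IM] := idI; rewrite !ideal_predE => /asboolP Ix; apply/asboolP/IM.
Qed.

Definition quotient : Type := {ideal_quot Ip}.
HB.instance Definition _ := GRing.Zmodule.on quotient.
HB.instance Definition _ := EqQuotient.on quotient.

Definition quotient_one : quotient := \pi_quotient 1.
Definition quotient_mul (x y : quotient) : quotient :=
  \pi_quotient (repr x * repr y).

Lemma quotient_eqP x y : reflect (\pi_quotient x = \pi_quotient y) (x - y \in Ip).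
Proof. by rewrite Quotient.idealrBE; apply: eqP. Qed.

Lemma pi_quotient_mul x y :
  quotient_mul (\pi_quotient x) (\pi_quotient y) = \pi_quotient (x * y).
Proof.
apply/quotient_eqP; set x' := repr _; set y' := repr _.
have -> : x' * y' - x * y = y' * (x' - x) + x * (y' - y).
  by ring.
by rewrite rpredD // ideal_predM //; apply/quotient_eqP; rewrite reprK.
Qed.

Lemma pi_quotient_add x y :
  \pi_quotient x + \pi_quotient y = \pi_quotient (x + y).
Proof. by rewrite -[RHS]/(\pi_{ideal_quot Ip} (x + y)) raddfD. Qed.

Lemma quotient_mulA : associative quotient_mul.
Proof.
elim/quotW=> x; elim/quotW=> y; elim/quotW=> z.
by rewrite (pi_quotient_mul y z) (pi_quotient_mul x y) !pi_quotient_mul mulrA.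
Qed.

Lemma quotient_mulC : commutative quotient_mul.
Proof. by move=> x y; rewrite /quotient_mul mulrC. Qed.

Lemma quotient_mul1 : left_id quotient_one quotient_mul.
Proof. by elim/quotW=> x; rewrite pi_quotient_mul mul1r. Qed.

Lemma quotient_mulD : left_distributive quotient_mul +%R.
Proof.
elim/quotW=> x; elim/quotW=> y; elim/quotW=> z.
rewrite (pi_quotient_add x y) (pi_quotient_mul (x + y) z).
by rewrite (pi_quotient_mul x z) (pi_quotient_mul y z) pi_quotient_add mulrDl.
Qed.

HB.instance Definition _ := GRing.Zmodule_isComPzRing.Build quotient
  quotient_mulA quotient_mulC quotient_mul1 quotient_mulD.

End Quotient.

Section Localization.
Variables (R : comPzRingType) (P : set R) (prP : prime_ideal P).

Definition denominator of prime_ideal P := {s : R | `[< ~ P s >]}.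
Local Notation D := (denominator prP).
HB.instance Definition _ := SubChoice.on D.

Lemma denominatorP (s : D) : ~ P (val s). Proof. exact/asboolP/(valP s). Qed.

Lemma denominator1_subproof : `[< ~ P 1 >].
Proof. by apply/asboolP; case: prP. Qed.
Definition denominator1 : D := exist _ 1 denominator1_subproof.

Lemma denominatorM_subproof (s t : D) : `[< ~ P (val s * val t) >].
Proof.
have [_ _ PM] := prP; apply/asboolP => /PM.
by case; apply: denominatorP.
Qed.
Definition denominatorM (s t : D) : D := exist _ (val s * val t) (denominatorM_subproof s t).

Lemma val_denominator1 : val denominator1 = 1. Proof. by []. Qed.
Lemma val_denominatorM s t : val (denominatorM s t) = val s * val t.
Proof. by []. Qed.
Let valE := (val_denominator1, val_denominatorM).

(* The pair (a, s) stands for the fraction a / s. *)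
Definition frac_equiv (x y : R * D) : bool :=
  `[< exists u : D, val u * (x.1 * val y.2) = val u * (y.1 * val x.2) >].

Lemma frac_equiv_is_equiv : equiv_class_of frac_equiv.
Proof.
split=> [x|x y|y x z].
- by apply/asboolP; exists denominator1.
- by apply/asboolP/asboolP=> -[u e]; exists u.
- move=> /asboolP[u exy] /asboolP[v eyz]; apply/asboolP.
  exists (denominatorM (denominatorM u v) y.2); rewrite !valE.
  transitivity (val v * val z.2 * (val u * (x.1 * val y.2))); first by ring.
  rewrite exy.
  transitivity (val u * val x.2 * (val v * (y.1 * val z.2))); first by ring.
  by rewrite eyz; ring.
Qed.

Canonical frac_equiv_equiv := EquivRelPack frac_equiv_is_equiv.
Canonical frac_equiv_encModRel := defaultEncModRel frac_equiv.

Definition localization : Type := {eq_quot frac_equiv}.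
HB.instance Definition _ := EqQuotient.on localization.
HB.instance Definition _ := Choice.on localization.
Implicit Types x y z : localization.

Definition frac (a : R) (s : D) : localization := \pi_localization (a, s).

Lemma frac_eqP a s b t :
  (exists u : D, val u * (a * val t) = val u * (b * val s)) <->
  frac a s = frac b t.
Proof.
split=> [e|/eqP]; first by apply/eqP; rewrite piE; apply/asboolP.
by rewrite piE => /asboolP.
Qed.

Lemma fracW (T : localization -> Prop) :
  (forall a s, T (frac a s)) -> forall x, T x.
Proof. by move=> H; elim/quotW=> -[a s]; apply: H. Qed.

Definition loc_zero : localization := frac 0 denominator1.
Definition loc_one : localization := frac 1 denominator1.
Definition loc_opp x : localization := frac (- (repr x).1) (repr x).2.
Definition loc_add x y : localization :=
  frac ((repr x).1 * val (repr y).2 + (repr y).1 * val (repr x).2)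
       (denominatorM (repr x).2 (repr y).2).
Definition loc_mul x y : localization :=
  frac ((repr x).1 * (repr y).1) (denominatorM (repr x).2 (repr y).2).

Lemma repr_frac a s : exists u : D,
  val u * ((repr (frac a s)).1 * val s) = val u * (a * val (repr (frac a s)).2).
Proof. by apply/frac_eqP; rewrite /frac -surjective_pairing reprK. Qed.

Lemma loc_opp_frac a s : loc_opp (frac a s) = frac (- a) s.
Proof.
apply/frac_eqP; have [u e] := repr_frac a s; exists u.
by rewrite !mulNr !mulrN e.
Qed.

Lemma loc_add_frac a s b t :
  loc_add (frac a s) (frac b t) = frac (a * val t + b * val s) (denominatorM s t).
Proof.
apply/frac_eqP; have [u e] := repr_frac a s; have [v e'] := repr_frac b t.
exists (denominatorM u v); rewrite !valE.
set x := repr _ in e *; set y := repr _ in e' *.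
transitivity (val v * val y.2 * val t * (val u * (x.1 * val s))
              + val u * val x.2 * val s * (val v * (y.1 * val t))); first by ring.
by rewrite e e'; ring.
Qed.

Lemma loc_mul_frac a s b t :
  loc_mul (frac a s) (frac b t) = frac (a * b) (denominatorM s t).
Proof.
apply/frac_eqP; have [u e] := repr_frac a s; have [v e'] := repr_frac b t.
exists (denominatorM u v); rewrite !valE.
set x := repr _ in e *; set y := repr _ in e' *.
transitivity ((val u * (x.1 * val s)) * (val v * (y.1 * val t))); first by ring.
by rewrite e e'; ring.
Qed.

Lemma frac_eq1 a s b t : a * val t = b * val s -> frac a s = frac b t.
Proof. by move=> e; apply/frac_eqP; exists denominator1; rewrite e. Qed.

Lemma loc_addA : associative loc_add.
Proof.
elim/fracW=> a s; elim/fracW=> b t; elim/fracW=> c u.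
rewrite (loc_add_frac b t) (loc_add_frac a s b t) !loc_add_frac.
by apply: frac_eq1; rewrite ?valE; ring.
Qed.

Lemma loc_addC : commutative loc_add.
Proof.
elim/fracW=> a s; elim/fracW=> b t.
by rewrite (loc_add_frac a) (loc_add_frac b); apply: frac_eq1; rewrite ?valE; ring.
Qed.

Lemma loc_add0 : left_id loc_zero loc_add.
Proof.
by elim/fracW=> a s; rewrite loc_add_frac; apply: frac_eq1; rewrite ?valE; ring.
Qed.

Lemma loc_addN : left_inverse loc_zero loc_opp loc_add.
Proof.
elim/fracW=> a s; rewrite loc_opp_frac loc_add_frac.
by apply: frac_eq1; rewrite ?valE; ring.
Qed.

HB.instance Definition _ :=
  GRing.isZmodule.Build localization loc_addA loc_addC loc_add0 loc_addN.

Lemma loc_mulA : associative loc_mul.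
Proof.
elim/fracW=> a s; elim/fracW=> b t; elim/fracW=> c u.
rewrite (loc_mul_frac b t) (loc_mul_frac a s b t) !loc_mul_frac.
by apply: frac_eq1; rewrite ?valE; ring.
Qed.

Lemma loc_mulC : commutative loc_mul.
Proof.
elim/fracW=> a s; elim/fracW=> b t.
by rewrite (loc_mul_frac a) (loc_mul_frac b); apply: frac_eq1; rewrite ?valE; ring.
Qed.

Lemma loc_mul1 : left_id loc_one loc_mul.
Proof.
by elim/fracW=> a s; rewrite loc_mul_frac; apply: frac_eq1; rewrite ?valE; ring.
Qed.

Lemma loc_mulD : left_distributive loc_mul loc_add.
Proof.
elim/fracW=> a s; elim/fracW=> b t; elim/fracW=> c u.
rewrite (loc_add_frac a s b t) (loc_mul_frac a s c u) (loc_mul_frac b t c u).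
rewrite loc_mul_frac loc_add_frac.
by apply: frac_eq1; rewrite ?valE; ring.
Qed.

HB.instance Definition _ := GRing.Zmodule_isComPzRing.Build localization
  loc_mulA loc_mulC loc_mul1 loc_mulD.

Definition to_localization (a : R) : localization := frac a denominator1.

End Localization.

Section FRational.
Variable R : comPzRingType.

(* The generators are existentially quantified: I is a parameter ideal when
   some finite generating family of I satisfies the local condition. *)
Definition parameter_ideal (I : set R) : Prop :=
  exists r : seq R, I = generated_ideal [set` r] /\
    forall (P : set R) (prP : prime_ideal P), I `<=` P ->
      part_of_system_of_parameters [seq to_localization prP x | x <- r].

Definition F_rational : Prop :=
  noetherian R /\
  exists2 p : nat, has_prime_char R p &
    forall I : set R, parameter_ideal I -> tightly_closed p I.

End FRational.

Arguments F_rational : clear implicits.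

Definition quotient_by (R : comPzRingType) (f : R) : comPzRingType :=
  quotient (generated_idealP [set f]).

Definition irreducible_element (R : comUnitRingType) (x : R) : Prop :=
  [/\ x != 0, x \isn't a GRing.unit
    & forall a b : R, x = a * b -> a \is a GRing.unit \/ b \is a GRing.unit].

Definition square_free_supported (K : fieldType) (n : nat)
    (f : {mpoly K[n]}) : Prop :=
  forall m : 'X_{1..n}, m \in msupp f -> forall i : 'I_n, (m i <= 1)%N.

(* Main.v *)
Require Import Defs.
From HB Require Import structures.
From mathcomp Require Import all_boot all_order all_algebra.
From mathcomp Require Import boolp classical_sets.
From mathcomp Require Import mpoly.
From mathcomp Require Import ring zify.

Set Implicit Arguments.
Unset Strict Implicit.
Unset Printing Implicit Defensive.

Import Order.TTheory GRing.Theory.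
Local Open Scope ring_scope.

(** Write R = S/(f) with f = g (1 + l) + h and l the sum of the a_i x_i. The
    proof shows more than F-rationality: every ideal of R is tightly closed.

    The mechanism is Fedder's. Let J be an ideal of S containing f and suppose
    that c r^q lies in J^[q] + (f) for q = p^e. Multiplying by f^(q-1) puts
    c f^(q-1) r^q in J^[q]. A q^-1-linear operator lam of S satisfies
    lam (y w^q) = lam y * w, hence carries J^[q] into J, and r * lam (c f^(q-1))
    lies in J. It is enough to reach 1 by iterating such operators; Frobenius
    powers then drop out and r belongs to J. The operators used here extract the
    coefficients of the monomials in one residue class modulo q ([cartier]); over
    an imperfect field this needs a linear retraction of K onto its subfield of
    q-th powers ([field_retraction]).

    Suppose first that F is prime and square-free supported and does not divide c.
    The variables are removed one at a time from the last to the first. If u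
    involves only the first variables up to x and has degree t < q in x, then
    u F^(q-1) has degree at most q - 1 in every later variable and at most
    t + q - 1 in x. When it has a monomial whose exponent in x lies between t and
    q - 1, the corresponding coefficient polynomial is not mixed with any other
    one by reduction modulo q: the operator yields a nonzero polynomial in which x
    and the later variables do not occur. If x occurs in F, such a monomial exists,
    because a gap in degrees t to q - 1 would make F divide u f1^q, where f1 is the
    coefficient of x in F ([coefficient_gap], [window_monomial]); otherwise no
    exponent of x reaches q, and any monomial will do. At the end a nonzero constant
    is left ([prime_test_element]).

    The polynomial f need not be square-free supported, because of l. Introduce a
    variable y and F = g y + h, which is. With x0 = y - l the ring K[x, y] is
    K[x, x0], F is homogeneous, and setting x0 = 1 turns F into f. So relations
    modulo f are homogenized, the result for F is applied to them, and x0 is set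
    to 1 again ([homogenize_frobenius_power_mod], [hypersurface_tight]). The
    same transfer shows that f is prime, so R is a domain and the multipliers c in
    the definition of tight closure are the nonzero elements of R.

    That F is irreducible follows from the irreducibility of g and from g not
    dividing h. It is prime since polynomial rings over a field are factorial
    ([mpoly_factorial], by Gauss's lemma). Finally R is noetherian by Hilbert's
    basis theorem ([mpoly_noetherian], from Dickson's lemma). *)

(** * Unique factorization in polynomial rings *)

Definition divides (R : comPzRingType) (x y : R) : Prop :=
  exists k, y = k * x.

Definition prime_element (R : comUnitRingType) (x : R) : Prop :=
  [/\ x != 0, x \isn't a GRing.unit
    & forall a b, divides x (a * b) -> divides x a \/ divides x b].

Definition factorial_ring (R : comUnitRingType) : Prop :=
  (forall x : R, irreducible_element x -> prime_element x) /\
  forall c : R, c != 0 -> exists2 s : seq R,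
    {in s, forall x, irreducible_element x}
    & exists2 w, w \is a GRing.unit & c = w * \prod_(x <- s) x.

Lemma dividesB (R : comPzRingType) (x a b : R) :
  divides x a -> divides x b -> divides x (a - b).
Proof. by case=> k -> [l ->]; exists (k - l); rewrite mulrBl. Qed.

Lemma prime_dividesX (R : comUnitRingType) (x a : R) k :
  prime_element x -> divides x (a ^+ k) -> divides x a.
Proof.
case=> _ xU px; elim: k => [[l e]|k IH].
  by case/negP: xU; apply/unitrP; exists l; rewrite [x * l]mulrC -e expr0.
by rewrite exprS => /px[].
Qed.

Lemma factor_ind (R : idomainType) (T : R -> Prop) : factorial_ring R ->
  (forall w, w \is a GRing.unit -> T w) ->
  (forall x c, prime_element x -> c != 0 -> T c -> T (c * x)) ->
  forall c, c != 0 -> T c.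
Proof.
move=> [irrP fac] Tu TM c /fac[s irr_s [w wU ->]].
elim: s irr_s => [|x s IH] irr_s; first by rewrite big_nil mulr1; apply: Tu.
have irrs y : y \in s -> irreducible_element y.
  by move=> ys; apply: irr_s; rewrite inE ys orbT.
rewrite big_cons [x * _]mulrC mulrA; apply: TM (IH irrs).
  by apply/irrP/irr_s; rewrite mem_head.
rewrite mulf_neq0 //; first by apply: contraTneq wU => ->; rewrite unitr0.
rewrite prodf_seq_neq0; apply/allP => y ys; apply/implyP => _.
by case: (irrs y ys).
Qed.

(** If x divides (a 'X + a0) (b 'X + b0), it divides a0 b0, hence a0 or b0. The
    corresponding constant term can then be dropped, which leaves a product with
    a factor of smaller degree. *)
Lemma prime_polyC (R : idomainType) (x : R) :
  prime_element x -> prime_element x%:P.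
Proof.
case=> x0 xU px; split; first by rewrite polyC_eq0.
  by rewrite poly_unitE coefC eqxx (negbTE xU) andbF.
move=> a b; elim/poly_ind: a b => [b _|a a0 IHa b].
  by left; exists 0; rewrite mul0r.
have main (p : {poly R}) (q : R) :
    divides x%:P (p * 'X + q%:P) <-> divides x%:P p /\ divides x q.
  split=> [[k e]|[[k ->] [l ->]]]; last first.
    by exists (k * 'X + l%:P); rewrite polyCM mulrDl -!mulrA [_ * 'X]mulrC.
  split; [exists (\poly_(i < size k) k`_i.+1)|exists (k`_0)]; last first.
    by move/(congr1 (coefp 0)): e; rewrite /= coefMC coefD coefMX coefC eqxx add0r.
  apply/polyP=> i; move/(congr1 (coefp i.+1)): e.
  rewrite /= !coefMC coefD coefMX coefC /= addr0 => ->; rewrite coef_poly.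
  by case: ltnP => // /leqW ki; rewrite nth_default.
elim/poly_ind: b => [_|b b0 IHb].
  by right; exists 0; rewrite mul0r.
rewrite !main => dab.
have [_ /px] : divides x%:P ((a * b * 'X + a * b0%:P + a0%:P * b) * 'X + (a0 * b0)%:P)
               /\ divides x (a0 * b0).
  have h : (a * 'X + a0%:P) * (b * 'X + b0%:P)
    = (a * b * 'X + a * b0%:P + a0%:P * b) * 'X + (a0 * b0)%:P.
    by rewrite polyCM; ring.
  by move: dab; rewrite h; split => //; move/main: dab => [].
have dCX (c : R) p : divides x c -> divides x%:P (p * c%:P).
  by case=> k ->; exists (p * k%:P); rewrite polyCM mulrA.
case=> d0.
- have: divides x%:P (a * (b * 'X + b0%:P)).
    have: divides x%:P (a * (b * 'X + b0%:P) * 'X + 0%:P).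
      rewrite polyC0 addr0 (_ : _ * 'X = (a * 'X + a0%:P) * (b * 'X + b0%:P) -
         (b * 'X + b0%:P) * a0%:P); last by ring.
      by apply: dividesB dab _; apply: dCX.
    by case/main.
  by case/IHa => [da|/main]; [left|right].
- have: divides x%:P ((a * 'X + a0%:P) * b).
    have: divides x%:P ((a * 'X + a0%:P) * b * 'X + 0%:P).
      rewrite polyC0 addr0 (_ : _ * 'X = (a * 'X + a0%:P) * (b * 'X + b0%:P) -
         (a * 'X + a0%:P) * b0%:P); last by ring.
      by apply: dividesB dab _; apply: dCX.
    by case/main.
  by case/IHb => [/main|db]; [left|right].
Qed.

Section GaussLemma.
Variable R : idomainType.
Hypothesis facR : factorial_ring R.
Implicit Types (f a b : {poly R}).

(** A prime factor of c is still prime as a constant polynomial and does not divide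
    f, so it divides the cofactor of f in c *: b and can be cancelled. *)
Lemma primitive_cancel f : (forall x : R, prime_element x -> ~ divides x%:P f) ->
  forall c, c != 0 -> forall b, divides f (c *: b) -> divides f b.
Proof.
move=> fprim; apply: (factor_ind facR) => [w wU b [k e]|x c xP c0 IH b].
  by exists (w^-1 *: k); rewrite -scalerAl -e scalerA mulVr // scale1r.
rewrite -scalerA => /IH[k]; have [x0 _ pM] := prime_polyC xP.
rewrite -mul_polyC => e.
have : divides x%:P (k * f) by exists b; rewrite -e mulrC.
case/pM => [[l kE]|]; last by move/fprim: xP.
by exists l; apply: (mulfI x0); rewrite e kE; ring.
Qed.

(** Each prime factor of c divides a or b and can be cancelled there. Only
    constants are moved, so a factorization over the field of fractions becomes
    one over R with factors of the same degrees. *)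
Lemma absorb_scalar c : c != 0 -> forall f a b, c *: f = a * b ->
  exists a' b' e, [/\ f = a' * b', e != 0 & b = e *: b'].
Proof.
move: c; apply: (factor_ind facR) => [w wU f a b e|x c xP c0 IH f a b].
  exists (w^-1 *: a), b, 1; split; rewrite ?oner_eq0 ?scale1r //.
  by rewrite -scalerAl -e scalerA mulVr // scale1r.
rewrite mulrC -scalerA -mul_polyC => e; have [x0 _ pM] := prime_polyC xP.
have : divides x%:P (a * b) by exists (c *: f); rewrite -e mulrC.
case/pM => [[k aE]|[k bE]].
  by apply: (IH f k b); apply: (mulfI x0); rewrite e aE; ring.
have /IH[a' [b' [d [-> d0 kE]]]] : c *: f = a * k.
  by apply: (mulfI x0); rewrite e bE; ring.
exists a', b', (x * d); split=> //; first by rewrite mulf_neq0 -?(polyC_eq0 x).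
by rewrite bE kE mulrC mul_polyC scalerA.
Qed.

Lemma irreducible_polyC (x : R) : irreducible_element x%:P -> irreducible_element x.
Proof.
case; rewrite polyC_eq0 poly_unitE coefC /= => x0; rewrite size_polyC x0 /= => xU irr.
split=> // a b e; have [] := irr a%:P b%:P; first by rewrite -polyCM -e.
  by rewrite poly_unitE coefC /= => /andP[_ ->]; left.
by rewrite poly_unitE coefC /= => /andP[_ ->]; right.
Qed.

(** Gauss's lemma. A nonconstant irreducible f has no constant prime divisor. Let f
    divide a * b. If f and a are coprime over the field of fractions, a Bezout
    relation shows that f divides c *: b for a constant c != 0; otherwise the gcd
    of f and a is f up to a constant, and f divides c *: a. *)
Lemma irreducible_poly_prime f : irreducible_element f -> prime_element f.
Proof.
move=> irrf; have [f0 fU irr] := irrf.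
have [/size_poly1P[c c0 fE]|szf] := boolP (size f == 1%N).
  rewrite fE in irrf *; apply/prime_polyC.
  by case: facR => H _; apply/H/irreducible_polyC.
have fprim x : prime_element x -> ~ divides x%:P f.
  case=> x0 xU _ [k fE]; case/irr: (fE) => [kU|].
    case/negP: szf; rewrite fE size_mul ?polyC_eq0 //; last first.
      by apply: contraNneq f0 => k0; rewrite fE k0 mul0r.
    by move: kU; rewrite poly_unitE size_polyC x0 addn1 => /andP[].
  by rewrite poly_unitE coefC /= (negbTE xU) andbF.
have cancelf := primitive_cancel fprim.
split=> // a b [w e].
have [cop|ncop] := boolP (coprimep f a).
  have /Bezout_coprimepP[[u v] /=] := cop.
  rewrite -size_poly_eq1 => /size_poly1P[c c0 cE]; right.
  apply: (cancelf c) => //; rewrite -mul_polyC -cE mulrDl.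
  exists (u * b + v * w); rewrite !mulrDl -!mulrA e; ring.
left; have /Pdiv.WeakIdomain.dvdpP[[c q] /= c0 cE] := dvdp_gcdl f a.
have /Pdiv.WeakIdomain.dvdpP[[c2 l] /= c20 c2E] := dvdp_gcdr f a.
have [k' [d' [g [fE g0 dE]]]] := absorb_scalar c0 cE.
have : k' \is a GRing.unit.
  case: (irr _ _ fE) => //; rewrite poly_unitE => /andP[/eqP sz1 _].
  by move: ncop; rewrite coprimep_def dE size_scale // sz1.
move=> kU; apply: (cancelf c2) => //; exists (g *: l * k'^-1).
by rewrite c2E dE fE mulrA mulrVK // -scalerAl scalerAr.
Qed.

End GaussLemma.

Lemma prime_element_transport (A B : comUnitRingType) (phi : {rmorphism A -> B})
    (psi : B -> A) : cancel phi psi -> cancel psi phi ->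
  (forall x : B, irreducible_element x -> prime_element x) ->
  forall x : A, irreducible_element x -> prime_element x.
Proof.
move=> phiK psiK irrP x [x0 xU irr].
have phi_inj := can_inj phiK.
have unitE y : (phi y \is a GRing.unit) = (y \is a GRing.unit).
  apply/idP/idP => [|yU]; last by rewrite rmorph_unit.
  move=> /unitrP[z [e1 e2]]; apply/unitrP; exists (psi z).
  by split; apply: phi_inj; rewrite rmorphM psiK rmorph1.
have [|y0 yU yP] := irrP (phi x).
- split=> [||a b].
  + by apply: contra_neq x0 => e; apply: phi_inj; rewrite e rmorph0.
  + by rewrite unitE.
  + by rewrite -[a]psiK -[b]psiK -rmorphM !unitE => /phi_inj /irr.
split=> // a b [k e].
have [|[l el]|[l el]] := yP (phi a) (phi b).
- by exists (phi k); rewrite -!rmorphM e.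
- by left; exists (psi l); apply: phi_inj; rewrite rmorphM psiK.
- by right; exists (psi l); apply: phi_inj; rewrite rmorphM psiK.
Qed.

Section MPolyFactorial.
Variable K : fieldType.

Lemma mpoly_unit_size n (u : {mpoly K[n]}) :
  u \is a GRing.unit = (msize u == 1%N).
Proof.
apply/idP/msize_poly1P => [|[c c0 ->]]; last by rewrite rmorph_unit // unitfE.
case/andP=> /eqP uE; rewrite unitfE => u0.
by exists u@_0%MM.
Qed.

(** A product of two nonunits has larger total degree than either of them. *)
Lemma mpoly_irreducible_factors n (c : {mpoly K[n]}) : c != 0 ->
  exists2 s : seq {mpoly K[n]}, {in s, forall x, irreducible_element x}
    & exists2 w, w \is a GRing.unit & c = w * \prod_(x <- s) x.
Proof.
have [m] := ubnP (msize c); elim: m c => // m IH c szc c0.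
have [cU|cU] := boolP (c \is a GRing.unit).
  by exists [::] => //; exists c; rewrite // big_nil mulr1.
have [irr|red] := pselect (irreducible_element c).
  exists [:: c]; first by move=> x; rewrite inE => /eqP->.
  by exists 1; rewrite ?unitr1 // big_seq1 mul1r.
have [a [b [cE aU bU]]] : exists a b, [/\ c = a * b, a \isn't a GRing.unit
    & b \isn't a GRing.unit].
  apply: contrapT => nab; apply: red; split=> // a b cE.
  have [aU|aU] := boolP (a \is a GRing.unit); first by left.
  by right; apply: contrapT => /negP bU; apply: nab; exists a, b.
have /andP[a0 b0] : (a != 0) && (b != 0) by rewrite -negb_or -mulf_eq0 -cE.
have szE := msizeM a0 b0; rewrite -cE in szE.
rewrite !mpoly_unit_size in aU bU.
have [sa1 sb1] : (1 < msize a)%N /\ (1 < msize b)%N.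
  by split; rewrite ltn_neqAle eq_sym ?aU ?bU lt0n msize_poly_eq0.
have lta : (msize a < msize c)%N.
  rewrite szE; case: (msize b) sb1 => [|[|k]] // _.
  by rewrite addnS /= -addn1 leq_add2l.
have ltb : (msize b < msize c)%N.
  by rewrite szE; case: (msize a) sa1 => [|[|k]] // _; rewrite addSn /= ltnS leq_addl.
have [s irrs [w wU aE]] := IH a (leq_trans lta szc) a0.
have [t irrt [v vU bE]] := IH b (leq_trans ltb szc) b0.
exists (s ++ t); first by move=> x; rewrite mem_cat => /orP[/irrs|/irrt].
exists (w * v); first by rewrite unitrM wU.
by rewrite big_cat /= cE aE bE; ring.
Qed.

(** The inverse of [muni], the isomorphism of K[x_1, ..., x_n, y] with
    K[x_1, ..., x_n][y]. *)
Definition of_uni n (p : {poly {mpoly K[n]}}) : {mpoly K[n.+1]} :=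
  (map_poly (@mwiden n K) p).['X_ord_max].

Lemma muni_monomial n (m : 'X_{1..n.+1}) :
  muni ('X_[m] : {mpoly K[n.+1]})
  = 'X_[[multinom m (widen_ord (leqnSn n) i) | i < n]] *: 'X^(m ord_max).
Proof. by rewrite muniE msuppX big_seq1 mcoeffX eqxx scale1r. Qed.

Lemma of_uniD n : {morph @of_uni n : p q / p + q}.
Proof. by move=> p q; rewrite /of_uni rmorphD hornerD. Qed.

Lemma of_uniM n : {morph @of_uni n : p q / p * q}.
Proof. by move=> p q; rewrite /of_uni rmorphM hornerM. Qed.

Lemma of_uniC n c : @of_uni n c%:P = mwiden c.
Proof. by rewrite /of_uni map_polyC hornerC. Qed.

Lemma of_uniX n : @of_uni n 'X = 'X_ord_max.
Proof. by rewrite /of_uni map_polyX hornerX. Qed.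

Lemma of_uniXn n k : @of_uni n 'X^k = 'X_ord_max ^+ k.
Proof. by rewrite /of_uni map_polyXn hornerXn. Qed.

Lemma muniK n : cancel (@muni n K) (@of_uni n).
Proof.
elim/mpolyind => [|c m p _ _ IH].
  by rewrite muni0 -[0]polyC0 of_uniC mwiden0.
rewrite muniD of_uniD [X in _ + X]IH; congr (_ + _).
rewrite muniZ muni_monomial -!mul_polyC !of_uniM !of_uniC of_uniXn.
rewrite mwidenC mwidenX mul_mpolyC mpolyXn -mpolyXD; congr (_ *: 'X_[_]).
apply/mnmP => i; rewrite mnmDE mulmnE mnm1E.
case: (unliftP ord_max i) => [j ->|->].
  rewrite (_ : lift _ j = widen_ord (leqnSn n) j) ?mnmwiden_widen ?mnmE.
    by rewrite -val_eqE /= gtn_eqF // addn0.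
  by apply: val_inj; rewrite /= /bump leqNgt ltn_ord.
by rewrite mnmwiden_ordmax eqxx mul1n.
Qed.

Lemma muni_widen n (c : {mpoly K[n]}) : muni (mwiden c) = c%:P.
Proof.
elim/mpolyind: c => [|a m p _ _ IH]; first by rewrite mwiden0 muni0 polyC0.
rewrite mwidenD muniD IH polyCD; congr (_ + _).
rewrite mwidenZ muniZ mwidenX muni_monomial mnmwiden_ordmax expr0.
rewrite -!mul_polyC mulr1 -polyCM mul_mpolyC; congr (_ *: 'X_[_])%:P.
by apply/mnmP => i; rewrite mnmE mnmwiden_widen.
Qed.

Lemma muni_max n : muni ('X_ord_max : {mpoly K[n.+1]}) = 'X.
Proof.
rewrite muni_monomial mnm1E eqxx expr1 (_ : [multinom _ | i < n] = 0%MM).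
  by rewrite mpolyX0 scale1r.
by apply/mnmP => i; rewrite mnmE mnm1E mnm0E -val_eqE /= gtn_eqF.
Qed.

Lemma of_uniK n : cancel (@of_uni n) (@muni n K).
Proof.
elim/poly_ind => [|p c IH]; first by rewrite -[0]polyC0 of_uniC muni_widen.
rewrite of_uniD of_uniM of_uniX of_uniC muniD muniM IH muni_max.
by rewrite muni_widen.
Qed.

Lemma mpoly_factorial n : factorial_ring {mpoly K[n]}.
Proof.
elim: n => [|n IH]; split; try exact: mpoly_irreducible_factors.
  move=> x [x0 /negP[]]; rewrite (nvar0_mpolyC x) rmorph_unit // unitfE.
  by apply: contra_neq x0 => e; rewrite (nvar0_mpolyC x) e.
apply: (prime_element_transport (@muniK n) (@of_uniK n)).
exact: irreducible_poly_prime.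
Qed.

End MPolyFactorial.

(** * Ideals *)

Section IdealFacts.
Variable R : comPzRingType.
Implicit Types (I J : set R) (A : set R).

Lemma ideal0 I : ideal I -> I 0. Proof. by case. Qed.
Lemma idealD I x y : ideal I -> I x -> I y -> I (x + y).
Proof. by case=> _ + _; apply. Qed.
Lemma idealMl I a x : ideal I -> I x -> I (a * x).
Proof. by case=> _ _; apply. Qed.
Lemma idealN I x : ideal I -> I x -> I (- x).
Proof. by move=> idI Ix; rewrite -mulN1r; apply: idealMl. Qed.
Lemma idealB I x y : ideal I -> I x -> I y -> I (x - y).
Proof. by move=> idI Ix Iy; apply: idealD => //; apply: idealN. Qed.

Lemma sub_generated_ideal A x : A x -> generated_ideal A x.
Proof. by move=> Ax J _; apply. Qed.

Lemma generated_ideal_sub A I : ideal I ->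
  (forall x, A x -> I x) -> forall x, generated_ideal A x -> I x.
Proof. by move=> idI sAI x; apply. Qed.

Lemma generated_ideal1P (f x : R) :
  generated_ideal [set f]%classic x <-> divides f x.
Proof.
split=> [|[k ->]]; last first.
  by apply: (idealMl _ (generated_idealP _)); apply: sub_generated_ideal.
move/(_ [set y | exists k, y = k * f]%classic); apply; last first.
  by move=> _ ->; exists 1; rewrite mul1r.
split; first by exists 0; rewrite mul0r.
  by move=> _ _ [k ->] [l ->]; exists (k + l); rewrite mulrDl.
by move=> a _ [k ->]; exists (a * k); rewrite mulrA.
Qed.

End IdealFacts.

Lemma noetherian_surj (R S : comPzRingType) (phi : R -> S) :
  (forall x y, phi (x + y) = phi x + phi y) ->
  (forall x y, phi (x * y) = phi x * phi y) ->
  (forall y, exists x, phi x = y) -> noetherian R -> noetherian S.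
Proof.
move=> phiD phiM phi_surj noeR I idI.
have phi0 : phi 0 = 0 by apply: (addrI (phi 0)); rewrite -phiD !addr0.
have [|r rE] := noeR [set x | I (phi x)]%classic.
  split=> [|x y /= Ix Iy|a x /= Ix]; rewrite /= ?phi0 ?phiD ?phiM.
  - exact: ideal0.
  - exact: idealD.
  - exact: idealMl.
exists (map phi r); apply/seteqP; split=> y.
  have [x <-] := phi_surj y => Ix.
  have : [set x | I (phi x)]%classic x by [].
  rewrite rE; pose J := generated_ideal [set` map phi r]%classic.
  apply: (@generated_ideal_sub _ _ [set x | J (phi x)]%classic).
    have idJ : ideal J by apply: generated_idealP.
    split=> [|u v /= Iu Iv|a u /= Iu]; rewrite /= ?phi0 ?phiD ?phiM.
    - exact: ideal0 idJ.
    - exact: idealD idJ _ _.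
    - exact: idealMl idJ _.
  move=> u /= ur; apply: sub_generated_ideal => /=; exact: map_f.
apply: generated_ideal_sub => // _ /= /mapP[x xr ->].
suff : [set x | I (phi x)]%classic x by [].
by rewrite rE; apply: sub_generated_ideal.
Qed.

(** * Hilbert's basis theorem *)

(** Dickson's lemma, one coordinate at a time: if a finite set s suffices for the
    first k coordinates and M bounds the k-th coordinate of its elements, then s
    handles the monomials whose k-th coordinate is at least M, and each of the
    finitely many slices below M has its own finite set. *)
Lemma dickson n (P : 'X_{1..n} -> Prop) :
  exists2 s : seq 'X_{1..n}, (forall m, m \in s -> P m)
    & forall m, P m -> exists2 m', m' \in s & (m' <= m)%MM.
Proof.
suff main k : forall Q : 'X_{1..n} -> Prop, exists2 s : seq 'X_{1..n},
    (forall m, m \in s -> Q m)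
    & forall m, Q m -> exists2 m', m' \in s
        & forall i : 'I_n, (i < k)%N -> (m' i <= m i)%N.
  have [s sP sm] := main n P; exists s => // m /sm[m' m's le].
  by exists m' => //; apply/mnm_lepP => i; apply: le.
elim: k => [|k IH] Q.
  have [[m0 Qm0]|nQ] := pselect (exists m, Q m); last first.
    by exists [::] => // m Qm; case: nQ; exists m.
  by exists [:: m0] => [m|m _]; [rewrite inE => /eqP->|exists m0; rewrite ?mem_head].
have [kn|nk] := ltnP k n; last first.
  have [s sQ sm] := IH Q; exists s => // m /sm[m' m's le]; exists m' => // i _.
  by apply: le; apply: leq_trans nk.
pose K := Ordinal kn; have [s sQ sm] := IH Q.
have slice v : {s : seq 'X_{1..n} | (forall m, m \in s -> Q m /\ m K = v) /\
    forall m, Q m /\ m K = v -> exists2 m', m' \in s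
        & forall i : 'I_n, (i < k)%N -> (m' i <= m i)%N}.
  by apply: cid; have [t tQ tm] := IH (fun m => Q m /\ m K = v); exists t.
pose M := \max_(m <- s) m K.
exists (s ++ flatten [seq sval (slice v) | v <- iota 0 M]).
  move=> m; rewrite mem_cat => /orP[/sQ//|/flatten_mapP[v _]].
  by case: (slice v) => /= t [tQ _] /tQ[].
move=> m Qm; have [Mm|mM] := leqP M (m K).
  have [m' m's le] := sm m Qm; exists m'; first by rewrite mem_cat m's.
  move=> i; rewrite ltnS leq_eqVlt => /orP[/eqP iK|]; last exact: le.
  rewrite (_ : i = K); last exact: val_inj.
  by apply: leq_trans Mm; apply: (leq_bigmax_seq m' m's).
have : exists2 m', m' \in sval (slice (m K)) &
   m' K = m K /\ forall i : 'I_n, (i < k)%N -> (m' i <= m i)%N.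
  case: (slice (m K)) => /= t [tQ tm]; have [//|m' m't le] := tm m.
  by exists m' => //; split=> //; have [] := tQ _ m't.
case=> m' m't [eqK le]; exists m'.
  rewrite mem_cat; apply/orP; right; apply/flatten_mapP; exists (m K) => //.
  by rewrite mem_iota.
move=> i; rewrite ltnS leq_eqVlt => /orP[/eqP iK|]; last exact: le.
by rewrite (_ : i = K) ?eqK //; apply: val_inj.
Qed.

(** By Dickson's lemma finitely many elements of I have leading monomials below
    those of all nonzero elements of I. They generate I, since subtracting a
    multiple of one of them lowers the leading monomial of any other element. *)
Lemma mpoly_noetherian (K : fieldType) n : noetherian {mpoly K[n]}.
Proof.
move=> I idI.
have [s sP sm] :=
  dickson (fun m => exists f : {mpoly K[n]}, [/\ I f, f != 0 & mlead f = m]).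
have pick m : {f : {mpoly K[n]} | m \in s -> [/\ I f, f != 0 & mlead f = m]}.
  apply: cid; have [/sP[f]|ms] := boolP (m \in s); first by exists f.
  by exists 0.
exists [seq sval (pick m) | m <- s]; apply/seteqP; split; last first.
  apply: generated_ideal_sub => // _ /= /mapP[m ms ->].
  by case: (pick m) => /= f /(_ ms)[].
set J := generated_ideal _; have idJ : ideal J by apply: generated_idealP.
apply: mleadrect => f IH If.
have [->|f0] := eqVneq f 0; first exact: ideal0 idJ.
have [|m ms le] := sm (mlead f); first by exists f.
have [g [Ig g0 gm] Jg] : exists2 g, [/\ I g, g != 0 & mlead g = m] & J g.
  exists (sval (pick m)); first by case: (pick m) => /= g /(_ ms).
  by apply: sub_generated_ideal => /=; apply: map_f.
pose c := mleadc f / mleadc g.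
have gc0 : mleadc g != 0 by rewrite mleadc_eq0.
have c0 : c != 0 by rewrite mulf_neq0 ?invr_eq0 // mleadc_eq0.
pose h := (c *: 'X_[mlead f - m]) * g.
have Xne : (c *: 'X_[mlead f - m] : {mpoly K[n]}) != 0.
  by rewrite mscalerI negb_or c0 -msupp_eq0 msuppX.
have hlead : mlead h = mlead f.
  by rewrite mleadM // mleadZ // mleadXm gm submK.
have hc : mleadc h = mleadc f.
  rewrite /h mleadcM_proper; last by rewrite mulf_neq0 // mleadc_eq0.
  by rewrite mleadZ // mleadXm mcoeffZ mcoeffX eqxx mulr1 divfK.
have -> : f = h + (f - h) by rewrite addrC subrK.
apply: (idealD idJ); first exact: idealMl idJ Jg.
have [->|d0] := eqVneq (f - h) 0; first exact: ideal0 idJ.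
apply: IH; last by apply: idealB => //; apply: idealMl.
have := mleadB_le f h; rewrite hlead joinxx le_eqVlt => /orP[/eqP e|//].
by move: d0; rewrite -mleadc_eq0 e mcoeffB -{2}hlead hc subrr eqxx.
Qed.

(** * Splittings of Frobenius *)

(** A maximal subspace that avoids 1 is a hyperplane complementary to the line of
    scalars, and the projection onto that line along it is a retraction. *)
Lemma field_retraction (K L : fieldType) (phi : {rmorphism K -> L}) :
  exists tau : {additive L -> K},
    (forall a b, tau (phi a * b) = a * tau b) /\ tau 1 = 1.
Proof.
pose sub (W : set L) := [/\ forall x y, W x -> W y -> W (x + y),
  forall a x, W x -> W (phi a * x) & ~ W 1].
have [W [[WD WM W1] Wmax]] : exists W, sub W /\ forall B, (W `<` B)%classic -> ~ sub B.
  apply: Zorn_bigcup => F sF totF; split.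
  - move=> x y [A FA Ax] [B FB By].
    have [AB|BA] := totF A B FA FB.
      by exists B => //; have [BD _ _] := sF B FB; apply: BD => //; apply: AB.
    by exists A => //; have [AD _ _] := sF A FA; apply: AD => //; apply: BA.
  - by move=> a x [A FA Ax]; exists A => //; have [_ AM _] := sF A FA; apply: AM.
  - by case=> A FA A1; have [_ _] := sF A FA.
have W_ext b : ~ W b -> exists w a, [/\ W w \/ w = 0, a != 0 & 1 = w + phi a * b].
  move=> Wb; apply: contrapT => no.
  (* W is not yet known to be nonempty, hence the alternative w = 0. *)
  pose B : set L := [set x | exists w a, (W w \/ w = 0) /\ x = w + phi a * b]%classic.
  apply: (Wmax B).
    split=> [x Wx|sBW].
      by exists x, 0; split; [left|rewrite rmorph0 mul0r addr0].
    by apply/Wb/sBW; exists 0, 1; split; [right|rewrite rmorph1 mul1r add0r].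
  split.
  - move=> _ _ [w [a [Ww ->]]] [v [c [Wv ->]]]; exists (w + v), (a + c).
    split; last by rewrite rmorphD; ring.
    case: Ww Wv => [Ww|->] [Wv|->]; rewrite ?add0r ?addr0; try by left.
      by left; apply: WD.
    by right.
  - move=> c _ [w [a [Ww ->]]]; exists (phi c * w), (c * a).
    split; last by rewrite rmorphM; ring.
    by case: Ww => [Ww|->]; [left; apply: WM|right; rewrite mulr0].
  - case=> w [a [Ww e]]; apply: no; exists w, a; split=> //.
    apply: contra_not_neq W1 => a0; case: Ww e => [Ww ->|-> /eqP].
      by rewrite a0 rmorph0 mul0r addr0.
    by rewrite a0 rmorph0 mul0r addr0 oner_eq0.
have W0 : W 0.
  apply: contrapT => /W_ext[w [a [Ww _]]]; rewrite mulr0 addr0 => e.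
  by case: Ww => [|/eqP]; rewrite -?e // oner_eq0.
have dec b : exists a, W (b - phi a).
  have [Wb|/W_ext[w [a [Ww a0 e]]]] := pselect (W b).
    by exists 0; rewrite rmorph0 subr0.
  have {}Ww : W w by case: Ww => [|->].
  exists a^-1; have -> : b - phi a^-1 = phi (- a^-1) * w.
    have -> : w = 1 - phi a * b by rewrite e addrK.
    by rewrite rmorphN mulNr mulrBr mulr1 mulrA -rmorphM mulVf // rmorph1; ring.
  exact: WM.
pose tau b := sval (cid (dec b)).
have tauP b : W (b - phi (tau b)) by rewrite /tau; case: cid.
have WN x : W x -> W (- x) by move=> /(WM (-1)); rewrite rmorphN1 mulN1r.
have tau_uniq b a : W (b - phi a) -> tau b = a.
  move=> Wba; apply/eqP; rewrite -subr_eq0; apply/negPn/negP => ne.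
  apply: W1; rewrite -(rmorph1 phi) -(mulVf ne) rmorphM; apply: WM.
  have -> : phi (tau b - a) = (b - phi a) - (b - phi (tau b)).
    by rewrite rmorphB; ring.
  by apply: WD => //; apply: WN.
have tauB : zmod_morphism tau.
  move=> x y; apply: tau_uniq.
  have -> : x - y - phi (tau x - tau y)
    = (x - phi (tau x)) - (y - phi (tau y)) by rewrite rmorphB; ring.
  by apply: WD => //; apply: WN.
pose t := GRing.isZmodMorphism.Build _ _ tau tauB.
pose T : {additive L -> K} := HB.pack tau t.
exists T; split=> [a b|] /=; apply: tau_uniq.
  have -> : phi a * b - phi (a * tau b) = phi a * (b - phi (tau b)).
    by rewrite rmorphM; ring.
  exact: WM.
by rewrite rmorph1 subrr.
Qed.

Lemma frobenius_additive (R : comNzRingType) (p e : nat) : p \in [pchar R] ->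
  forall x y : R, (x + y) ^+ (p ^ e) = x ^+ (p ^ e) + y ^+ (p ^ e).
Proof.
move=> pR x y; apply: exprDn_pchar; apply/pnatP => [|l lp].
  by rewrite expn_gt0 prime_gt0 // (pcharf_prime pR).
rewrite Euclid_dvdX // => /andP[].
by rewrite dvdn_prime2 ?(pcharf_prime pR) // => /eqP->.
Qed.

(** The retraction of K onto its subfield of q-th powers, followed by the q-th
    root. *)
Lemma frobenius_splitting (K : fieldType) (p e : nat) : p \in [pchar K] ->
  exists tau : {additive K -> K},
    (forall a b, tau (a ^+ (p ^ e) * b) = a * tau b) /\ tau 1 = 1.
Proof.
move=> pK; pose f (x : K) := x ^+ (p ^ e).
have q0 : (0 < p ^ e)%N by rewrite expn_gt0 prime_gt0 // (pcharf_prime pK).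
have fN x : f (- x) = - f x.
  apply/eqP; rewrite -addr_eq0 /f -frobenius_additive // addNr expr0n.
  by rewrite eqn0Ngt q0.
have fB : zmod_morphism f.
  by move=> x y; rewrite /f frobenius_additive // -/(f _) -/(f (- y)) fN.
have fM : monoid_morphism f.
  by split=> [|x y]; [exact: expr1n|exact: exprMn].
pose f1 := GRing.isZmodMorphism.Build _ _ f fB.
pose f2 := GRing.isMonoidMorphism.Build _ _ f fM.
pose F : {rmorphism K -> K} := HB.pack f f1 f2.
exact: (field_retraction F).
Qed.

Section CartierOperator.
Variables (K : fieldType) (p e n : nat).
Hypothesis pK : p \in [pchar K].
Local Notation q := (p ^ e)%N.
Variables (tau : {additive K -> K}) (beta : 'X_{1..n}).
Hypothesis tauM : forall a b, tau (a ^+ q * b) = a * tau b.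
Hypothesis beta_lt : forall i, (beta i < q)%N.

Let q_gt0 : (0 < q)%N.
Proof. by rewrite expn_gt0 prime_gt0 // (pcharf_prime pK). Qed.

(** The q^-1-linear operator that sends a 'X_[m *+ q + beta] to tau a 'X_[m] and
    kills the monomials outside the class of beta modulo q. Monomials of degree at
    least msize y contribute nothing, so the bound only makes the sum finite. *)
Definition cartier (y : {mpoly K[n]}) : {mpoly K[n]} :=
  \sum_(m : 'X_{1..n < msize y}) tau y@_(m *+ q + beta) *: 'X_[m].

Lemma cartier_coeff y m : (cartier y)@_m = tau y@_(m *+ q + beta).
Proof.
have [lt|ge] := ltnP (mdeg m) (msize y).
  exact: (mcoeff_mpoly (fun m => tau y@_(m *+ q + beta)) lt).
rewrite (memN_msupp_eq0 (p := y)) ?raddf0; last first.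
  apply/msize_mdeg_ge/(leq_trans ge); rewrite mdegD mdegMn.
  by apply: leq_trans (leq_addr _ _); rewrite leq_pmulr.
rewrite /cartier raddf_sum /= big1 // => k _; rewrite mcoeffZ mcoeffX.
by case: eqP => [km|_]; rewrite ?mulr0 //; move: (bmdeg k); rewrite km ltnNge ge.
Qed.

Lemma cartierD : {morph cartier : y z / y + z}.
Proof.
by move=> y z; apply/mpolyP => m; rewrite mcoeffD !cartier_coeff mcoeffD raddfD.
Qed.

Lemma cartier0 : cartier 0 = 0.
Proof. by apply/mpolyP => m; rewrite cartier_coeff !mcoeff0 raddf0. Qed.

Lemma cartierM y w : cartier (y * w ^+ q) = cartier y * w.
Proof.
elim/mpolyind: w => [|c m w _ _ IH].
  by rewrite expr0n eqn0Ngt q_gt0 !mulr0 cartier0.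
have pB : p \in [pchar {mpoly K[n]}] by rewrite pchar_lalg.
rewrite (frobenius_additive e pB) !mulrDr cartierD [X in _ + X]IH; congr (_ + _).
rewrite exprZn mpolyXn -!scalerAr; apply/mpolyP => k.
rewrite cartier_coeff !mcoeffZ tauM; congr (_ * _).
have [mk|mk] := boolP (m <= k)%MM.
  have kE : k = (m + (k - m))%MM by rewrite addmC submK.
  rewrite kE mcoeffMX cartier_coeff; congr (tau _).
  rewrite (_ : _ + beta = m *+ q + ((k - m) *+ q + beta))%MM ?mcoeffMX //.
  by apply/mnmP => i; rewrite !(mnmDE, mulmnE) mulnDl addnA.
(* The entries of beta are below q, so m *+ q <= k *+ q + beta forces m <= k. *)
rewrite !memN_msupp_eq0 ?raddf0 //; apply/negP.
  move=> /msuppM_le /allpairsP[[k1 k2] /= [_]].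
  by rewrite msuppX inE => /eqP-> kE; case/negP: mk; rewrite kE lem_addl.
move=> /msuppM_le /allpairsP[[k1 k2] /= [_]].
rewrite msuppX inE => /eqP-> kE; case/negP: mk; apply/mnm_lepP => i.
move/mnmP/(_ i): kE; rewrite !mnmDE !mulmnE => kE.
rewrite -ltnS -(ltn_pmul2r q_gt0) mulSnr.
apply: (@leq_ltn_trans (k i * q + beta i)); first by rewrite kE leq_addl.
by rewrite ltn_add2l.
Qed.

Lemma cartier_ideal J y : ideal J -> frobenius_power J q y -> J (cartier y).
Proof.
move=> idJ Jy.
suff : [set x | forall c, J (cartier (c * x))]%classic y by move/(_ 1); rewrite mul1r.
apply: generated_ideal_sub Jy.
  split=> [c|x z Jx Jz c|a x Jx c].
  - by rewrite mulr0 cartier0; apply: ideal0 idJ.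
  - by rewrite mulrDr cartierD; apply: idealD idJ _ _.
  - by rewrite mulrA.
by move=> _ [x Jx <-] c; rewrite cartierM; apply: idealMl idJ Jx.
Qed.

End CartierOperator.

(** * Degree in one variable *)

(** The polynomial seen as univariate in 'X_i, with coefficients that do not
    involve 'X_i but stay in the same ring. *)
HB.lock Definition uni (K : fieldType) (n : nat) (i : 'I_n) (y : {mpoly K[n]}) :
    {poly {mpoly K[n]}} :=
  mmap (polyC \o @mpolyC n K) (fun j => if j == i then 'X else ('X_j)%:P) y.

Section DegreeIn.
Variables (K : fieldType) (n : nat) (i : 'I_n).
Implicit Types (a b y : {mpoly K[n]}) (m : 'X_{1..n}).

Definition degree_in y : nat := \max_(m <- msupp y) m i.

Lemma degree_in_supp y m : m \in msupp y -> (m i <= degree_in y)%N.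
Proof. by move=> my; apply: (leq_bigmax_seq m my). Qed.

Lemma degree_inP y k :
  (forall m, m \in msupp y -> (m i <= k)%N) -> (degree_in y <= k)%N.
Proof. by move=> yk; apply/bigmax_leqP_seq => m my _; apply: yk. Qed.

Lemma degree_in_attained y : y != 0 ->
  exists2 m, m \in msupp y & m i = degree_in y.
Proof.
rewrite -msupp_eq0 /degree_in; elim: (msupp y) => // m s IH _.
rewrite big_cons; have [->|s0] := eqVneq s [::].
  by exists m; rewrite ?mem_head // big_nil maxn0.
have [m' m's <-] := IH s0; have [le|lt] := leqP (m i) (m' i).
  by exists m'; rewrite ?inE ?m's ?orbT //; apply/esym/maxn_idPr.
by exists m; rewrite ?mem_head //; apply/esym/maxn_idPl/ltnW.
Qed.

Local Notation uni := (@uni K n i).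

Lemma uniD : {morph uni : y z / y + z}.
Proof. by rewrite unlock; apply: mmapD. Qed.

Lemma uniM : {morph uni : y z / y * z}.
Proof.
by rewrite unlock; apply: (rmorphM (mmap (polyC \o @mpolyC n K) _)).
Qed.

Lemma uniX k : {morph uni : y / y ^+ k}.
Proof.
by move=> y; rewrite unlock; apply: (rmorphXn (mmap (polyC \o @mpolyC n K) _)).
Qed.

Lemma uni0 : uni 0 = 0.
Proof. by rewrite unlock; apply: mmap0. Qed.

Lemma uniZ c y : uni (c *: y) = c%:MP *: uni y.
Proof. by rewrite -mul_polyC unlock; apply: mmapZ. Qed.

Lemma uni_monomial m :
  uni 'X_[m] = 'X_[m - U_(i) *+ m i] *: 'X^(m i).
Proof.
rewrite unlock mmapX /mmap1 (bigD1 i) //= eqxx mulrC -mul_polyC; congr (_ * _).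
rewrite mpolyXE_id rmorph_prod /= [RHS](bigD1 i) //= mnmBE mulmnE mnm1E eqxx.
rewrite mul1n subnn expr0 mul1r; apply: eq_bigr => j /negbTE ji.
by rewrite ji mnmBE mulmnE mnm1E eq_sym ji mul0n subn0 rmorphXn.
Qed.

Lemma horner_uni y : (uni y).['X_i] = y.
Proof.
elim/mpolyind: y => [|c m y _ _ IH]; first by rewrite uni0 horner0.
rewrite uniD hornerD [X in _ + X]IH uniZ uni_monomial !hornerZ hornerXn.
rewrite mpolyXn mul_mpolyC -mpolyXD submK //; apply/mnm_lepP => j.
by rewrite mulmnE mnm1E; case: eqP => [<-|]; rewrite ?mul1n ?mul0n.
Qed.

Lemma coef_uni y k m :
  (uni y)`_k@_m = if m i == 0%N then y@_(m + U_(i) *+ k) else 0.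
Proof.
elim/mpolyind: y => [|c m' y _ _ IH].
  by rewrite uni0 coef0 !mcoeff0 if_same.
rewrite uniD coefD mcoeffD [X in _ + X = _]IH uniZ uni_monomial !coefZ coefXn.
rewrite mul_mpolyC mcoeffZ mulr_natr mcoeffMn mcoeffX mcoeffD mcoeffZ mcoeffX.
have [mi|mi] := eqVneq (m i) 0%N; last first.
  rewrite (_ : (_ == m) = false) ?mul0rn ?mulr0 ?addr0 //.
  apply: contraNF mi => /eqP <-.
  by rewrite mnmBE mulmnE mnm1E eqxx mul1n subnn.
congr (c * _ + _); rewrite -mulrnA mulnb; congr (_%:R); congr nat_of_bool.
apply/andP/eqP => [[/eqP <- /eqP ->]|->].
  rewrite submK //; apply/mnm_lepP => j; rewrite mulmnE mnm1E.
  by case: eqP => [<-|]; rewrite ?mul1n ?mul0n.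
rewrite !mnmDE !mulmnE mnm1E eqxx mi mul1n add0n eqxx; split=> //.
apply/eqP/mnmP => j; rewrite mnmBE mnmDE !mulmnE.
by rewrite addnK.
Qed.

Lemma size_uni y : y != 0 -> size (uni y) = (degree_in y).+1.
Proof.
move=> y0; apply/eqP; rewrite eqn_leq; apply/andP; split.
  apply/leq_sizeP => j ltj; apply/mpolyP => m; rewrite coef_uni mcoeff0.
  case: eqP => // mi; apply/memN_msupp_eq0/negP => /degree_in_supp.
  by rewrite mnmDE mulmnE mnm1E eqxx mi add0n mul1n leqNgt ltj.
have [m my <-] := degree_in_attained y0.
rewrite ltnNge; apply/negP => /leq_sizeP /(_ (m i) (leqnn _)) /mpolyP.
move=> /(_ (m - U_(i) *+ m i)%MM); rewrite coef_uni mcoeff0.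
rewrite mnmBE mulmnE mnm1E eqxx mul1n subnn eqxx submK.
  by move/eqP; rewrite mcoeff_eq0 my.
by apply/mnm_lepP => j; rewrite mulmnE mnm1E; case: eqP => [<-|]; rewrite ?mul1n ?mul0n.
Qed.

Lemma degree_inM a b : a != 0 -> b != 0 ->
  degree_in (a * b) = (degree_in a + degree_in b)%N.
Proof.
move=> a0 b0; have ab0 : a * b != 0 by rewrite mulf_neq0.
have uni_neq0 y : y != 0 -> uni y != 0.
  by move=> y0; rewrite -size_poly_eq0 (size_uni y0).
apply: succn_inj; rewrite -(size_uni ab0) uniM.
rewrite (size_mul (uni_neq0 _ a0) (uni_neq0 _ b0)).
by rewrite (size_uni a0) (size_uni b0) addnS.
Qed.

Lemma degree_inX a k : a != 0 -> degree_in (a ^+ k) = (k * degree_in a)%N.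
Proof.
move=> a0; elim: k => [|k IH]; last first.
  by rewrite exprS degree_inM ?expf_neq0 // IH mulSn.
by rewrite /degree_in msupp1 big_seq1 mnm0E.
Qed.

Lemma degree_in_divides a b : b != 0 -> divides a b ->
  (degree_in a <= degree_in b)%N.
Proof.
move=> b0 [c bE]; rewrite bE degree_inM ?leq_addl //.
  by apply: contraNneq b0 => c0; rewrite bE c0 mul0r.
by apply: contraNneq b0 => a0; rewrite bE a0 mulr0.
Qed.

End DegreeIn.

(** * Square-free supported primes *)

(** With F = f1 'X + f0 and G = u * F ^+ q.-1, the additivity of Frobenius gives
    F * G = u f0^q + u f1^q 'X^q. If G has no coefficient in degrees t to q-1, then
    F times the part of G below the gap stays in degree at most t, so it does not
    meet 'X^q: the part above the gap, times F, has to be u f1^q 'X^q. *)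
Lemma coefficient_gap (D : comNzRingType) (p e : nat) (pD : p \in [pchar D])
    (u : {poly D}) (f1 f0 : D) (t : nat) (F := f1 *: 'X + f0%:P) :
  (size u <= t.+1)%N -> (t < p ^ e)%N ->
  (forall k, (t <= k < p ^ e)%N -> (u * F ^+ (p ^ e).-1)`_k = 0) ->
  exists h, u * (f1 ^+ (p ^ e))%:P = h * F.
Proof.
move=> szu tq.
have Fq : F ^+ (p ^ e) = f1 ^+ (p ^ e) *: 'X^(p ^ e) + (f0 ^+ (p ^ e))%:P.
  have pP : p \in [pchar {poly D}] by apply: (rmorph_pchar (@polyC D)).
  by rewrite frobenius_additive // exprZn polyC_exp.
set q := (p ^ e)%N in tq Fq *; move=> gap; set G := u * F ^+ q.-1 in gap.
pose low := take_poly q G; pose h := drop_poly q G.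
have GE : G = low + h * 'X^q by rewrite poly_take_drop.
have szF : (size F <= 2)%N.
  rewrite (leq_trans (size_polyD _ _)) // geq_max size_polyC.
  by rewrite (leq_trans (size_scale_leq _ _)) ?size_polyX //; case: eqP.
have szlow : (size low <= t)%N.
  apply/leq_sizeP => j tj; rewrite coef_take_poly; case: ltnP => // jq.
  by rewrite gap // tj.
have FG : low * F + h * F * 'X^q = u * (f0 ^+ q)%:P + u * (f1 ^+ q)%:P * 'X^q.
  transitivity (G * F); first by rewrite GE; ring.
  rewrite /G -mulrA -exprSr prednK ?(leq_trans _ tq) // Fq -mul_polyC; ring.
exists h; apply/polyP => k; move/(congr1 (coefp (k + q))): FG => /=.
rewrite !coefD !coefMXn !ltnNge !leq_addl /= !addnK.
rewrite [(low * F)`_ _]nth_default ?[(u * _)`_ (k + q)]nth_default ?add0r //.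
  rewrite (leq_trans (size_polyMleq _ _)) // size_polyC; case: eqP => _; lia.
rewrite (leq_trans (size_polyMleq _ _)) //; lia.
Qed.

Lemma frobenius_powerM (R : comPzRingType) (J : set R) (q q' : nat) (x : R) :
  frobenius_power J (q' * q) x -> frobenius_power (frobenius_power J q') q x.
Proof.
apply: generated_ideal_sub; first exact: generated_idealP.
move=> _ [y Jy <-]; apply: sub_generated_ideal; exists (y ^+ q').
  by apply: sub_generated_ideal; exists y.
by rewrite exprM.
Qed.

Section SquareFree.
Variables (K : fieldType) (p n : nat).
Hypothesis pK : p \in [pchar K].
Local Notation B := {mpoly K[n]}.

Let p_prime : prime p. Proof. exact: pcharf_prime pK. Qed.
Let q_gt0 e : (0 < p ^ e)%N. Proof. by rewrite expn_gt0 prime_gt0. Qed.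

(** The operator attached to the class of m0 modulo q. Under the hypothesis, each
    monomial m of G in this class has m i < q, hence quotient 0 by q, for the
    variables i in A. Those variables therefore disappear, while m0 guarantees a
    nonzero coefficient. *)
Lemma cartier_extract e (G : B) (m0 : 'X_{1..n}) (A : pred 'I_n) :
  m0 \in msupp G ->
  (forall i m, A i -> m \in msupp G -> m i = m0 i %[mod p ^ e] ->
     (m i < p ^ e)%N) ->
  exists v : B, [/\ v != 0, forall i, A i -> degree_in i v = 0%N
    & forall J w, ideal J ->
        frobenius_power J (p ^ e) (G * w ^+ (p ^ e)) -> J (v * w)].
Proof.
move=> m0G noWrap.
have [tau [tauM tau1]] := frobenius_splitting e pK.
(* Scaling G makes its coefficient at m0 equal to 1, which tau does not kill. *)
pose c := (G@_m0)^-1; set q := (p ^ e)%N in noWrap tauM *.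
have G0 : G@_m0 != 0 by rewrite -mcoeff_msupp.
pose beta := [multinom (m0 i %% q)%N | i < n].
have beta_lt i : (beta i < q)%N by rewrite mnmE ltn_pmod // q_gt0.
pose v := cartier p e tau beta (c *: G); exists v; split.
- apply/eqP => /mpolyP/(_ [multinom (m0 i %/ q)%N | i < n]).
  rewrite cartier_coeff // mcoeffZ mcoeff0 (_ : (_ + _)%MM = m0).
    by rewrite mulVf // tau1 => /eqP; rewrite oner_eq0.
  by apply/mnmP => i; rewrite mnmDE mulmnE !mnmE -divn_eq.
- move=> i Ai; apply/eqP; rewrite -leqn0; apply: degree_inP => m.
  rewrite mcoeff_msupp cartier_coeff // mcoeffZ => ne.
  have mG : (m *+ q + beta)%MM \in msupp G.
    by rewrite mcoeff_msupp; apply: contra_neq ne => ->; rewrite mulr0 raddf0.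
  have := noWrap i _ Ai mG; rewrite mnmDE mulmnE mnmE => h.
  have := h; rewrite modnMDl modn_mod => /(_ erefl); case: (m i) => // k.
  by rewrite mulSn -addnA ltnNge leq_addr.
move=> J w idJ Jx; rewrite -(cartierM pK tauM beta_lt).
apply: (cartier_ideal pK tauM beta_lt) => //; rewrite -scalerAl -mul_mpolyC.
exact: idealMl (generated_idealP _) Jx.
Qed.

Variable F : B.
Hypothesis F_sqfree : square_free_supported F.
Hypothesis F_prime : prime_element F.

Let F0 : F != 0. Proof. by case: F_prime. Qed.

Let degF i : (degree_in i F <= 1)%N.
Proof. by apply: degree_inP => m /F_sqfree. Qed.

Lemma sqfree_power_degree i (u : B) e : u != 0 ->
  (degree_in i (u * F ^+ (p ^ e).-1) < degree_in i u + p ^ e)%N.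
Proof.
move=> u0; rewrite degree_inM ?expf_neq0 // degree_inX // ltn_add2l.
have := q_gt0 e; have := degF i; nia.
Qed.

(** Let t be the degree of u in 'X_i, so that exponents of 'X_i in u F^(q-1) are at
    most t + q - 1. An exponent between t and q - 1 is then alone in its class
    modulo q. If none occurs, F divides u f1^q with f1 the coefficient of 'X_i in
    F, hence divides f1; this is impossible when F involves 'X_i, since f1 does
    not. If F does not involve 'X_i, all exponents are at most t < q. *)
Lemma window_monomial i e (u : B) : ~ divides F u -> (degree_in i u < p ^ e)%N ->
  exists2 m0, m0 \in msupp (u * F ^+ (p ^ e).-1)
    & forall m, m \in msupp (u * F ^+ (p ^ e).-1) ->
        m i = m0 i %[mod p ^ e] -> (m i < p ^ e)%N.
Proof.
move=> Fu ltq; set q := (p ^ e)%N in ltq *; set G := u * _.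
have u0 : u != 0 by apply: contra_notN Fu => /eqP->; exists 0; rewrite mul0r.
have G0 : G != 0 by rewrite mulf_neq0 ?expf_neq0.
have [Fi|Fi] := posnP (degree_in i F).
  have [m0 m0G _] := degree_in_attained i G0; exists m0 => // m mG _.
  apply: leq_ltn_trans ltq; apply: leq_trans (degree_in_supp i mG) _.
  by rewrite /G degree_inM ?expf_neq0 // degree_inX // Fi muln0 addn0.
have [[m0 m0G /andP[m0t m0q]]|none] :=
    pselect (exists2 m0, m0 \in msupp G & (degree_in i u <= m0 i < q)%N).
  exists m0 => // m mG mod_eq; rewrite ltnNge; apply/negP => qm.
  have := degree_in_supp i mG; rewrite leqNgt => /negP[].
  apply: leq_trans (sqfree_power_degree i e u0) _; rewrite -/q.
  have mE := divn_eq (m i) q; rewrite mod_eq (modn_small m0q) in mE.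
  rewrite mE addnC leq_add // leq_pmull // divn_gt0 //.
  exact: leq_trans m0q.
case: F_prime => _ _ Fdiv; exfalso.
pose f1 := (uni i F)`_1; pose f0 := (uni i F)`_0.
have FE : uni i F = f1 *: 'X + f0%:P.
  apply/polyP => k; rewrite coefD coefZ coefX coefC /f1 /f0.
  case: k => [|[|k]]; rewrite ?mulr0 ?add0r ?mulr1 ?addr0 //=.
  apply: nth_default; rewrite size_uni // ltnS.
  by apply: leq_trans (degF i) _.
have pB : p \in [pchar B] by rewrite pchar_lalg.
have [|||h hE] := @coefficient_gap B p e pB (uni i u) f1 f0 (degree_in i u).
- by rewrite size_uni.
- exact: ltq.
- move=> k kq; rewrite -FE.
  have -> : uni i u * uni i F ^+ q.-1 = uni i G.
    by rewrite /G uniM uniX.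
  apply/mpolyP => m; rewrite coef_uni mcoeff0; case: eqP => // mi.
  apply: memN_msupp_eq0; apply/negP => mG; apply: none.
  by exists (m + U_(i) *+ k)%MM; rewrite // mnmDE mulmnE mnm1E eqxx mi mul1n.
rewrite -FE in hE.
have : divides F (u * f1 ^+ q).
  exists h.['X_i]; move/(congr1 (fun r => r.['X_i])): hE.
  by rewrite !hornerM hornerC !horner_uni.
case/Fdiv => [//|/(prime_dividesX F_prime)].
have f1_0 : f1 != 0.
  rewrite /f1 -[1%N](_ : (size (uni i F)).-1 = 1%N) ?lead_coef_eq0.
    by rewrite -size_poly_eq0 size_uni.
  rewrite size_uni //=; have := degF i; lia.
move=> /(degree_in_divides i f1_0); rewrite leqNgt => /negP[].
apply: leq_ltn_trans Fi; apply: degree_inP => m.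
by rewrite mcoeff_msupp coef_uni; case: ifP => [/eqP->|]; rewrite ?eqxx.
Qed.

(** If F is in J and u r^q is in J^[q] + (F), multiplication by F^(q-1) gives the
    membership assumed here. So modulo F a single relation, in an exponent that
    depends on u but neither on J nor on r, forces r into J. *)
Definition test_element (u : B) : Prop := forall e0, exists2 e, (e0 <= e)%N
  & forall J r, ideal J ->
      frobenius_power J (p ^ e) (u * F ^+ (p ^ e).-1 * r ^+ (p ^ e)) -> J r.

Lemma test_element_const (u : B) : u != 0 ->
  (forall i, degree_in i u = 0%N) -> test_element u.
Proof.
move=> u0 ui e; exists e => // J r idJ.
set G := u * _; have G0 : G != 0 by rewrite mulf_neq0 ?expf_neq0.
have m0G : mlead G \in msupp G by rewrite mlead_supp.
have [|v [v0 vA vJ]] := @cartier_extract e G (mlead G) predT m0G.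
  move=> i m _ mG _; apply: leq_ltn_trans (degree_in_supp i mG) _.
  by have := sqfree_power_degree i e u0; rewrite ui.
move/(vJ _ _ idJ).
have vE : v = (v@_0)%:MP.
  apply/mpolyP => m; rewrite mcoeffC; case: eqP => [->|/eqP m0]; rewrite ?mulr1 //.
  rewrite mulr0; apply: memN_msupp_eq0; apply: contraNN m0 => mv.
  apply/eqP/mnmP => i; have := degree_in_supp i mv; rewrite vA // mnm0E.
  by rewrite leqn0 => /eqP.
have c0 : v@_0 != 0 by apply: contra_neq v0 => c0; rewrite vE c0.
move/(idealMl (v@_0)^-1%:MP idJ); rewrite mulrA {2}vE -mpolyCM mulVf //.
by rewrite mpolyC1 mul1r.
Qed.

(** Eliminates 'X_i. Writing q q' - 1 = (q - 1) + q (q' - 1), the operator of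
    exponent e applied to u F^(q q' - 1) r^(q q') gives v F^(q' - 1) r^q', so a
    test exponent for v yields one for u. *)
Lemma test_element_step (i : 'I_n) (u : B) : ~ divides F u ->
  (forall j : 'I_n, (i < j)%N -> degree_in j u = 0%N) ->
  exists2 v : B, v != 0 /\ (forall j : 'I_n, (i <= j)%N -> degree_in j v = 0%N)
    & test_element v -> test_element u.
Proof.
move=> Fu uj.
have u0 : u != 0 by apply: contra_notN Fu => /eqP->; exists 0; rewrite mul0r.
(* Any e with degree_in i u < p ^ e would do. *)
pose e := degree_in i u.
have ltq : (degree_in i u < p ^ e)%N by apply: ltn_expl; apply: prime_gt1.
have [m0 m0G m0i] := window_monomial Fu ltq.
have [|v [v0 vA vJ]] := @cartier_extract e _ m0 (fun j : 'I_n => (i <= j)%N) m0G.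
  move=> j m; rewrite leq_eqVlt => /orP[/eqP/val_inj <-|ij mG _]; first exact: m0i.
  apply: leq_ltn_trans (degree_in_supp j mG) _.
  by have := sqfree_power_degree j e u0; rewrite uj.
exists v => // vT e0; have [e' e'0 e'J] := vT e0.
exists (e' + e)%N; first by apply: leq_trans e'0 _; apply: leq_addr.
move=> J r idJ Jx; apply: (e'J J r idJ); rewrite -mulrA.
apply: (vJ _ _ (generated_idealP _)).
apply: frobenius_powerM; rewrite -expnD.
move: Jx; congr (frobenius_power J _ _); rewrite exprMn -!exprM -expnD mulrA.
congr (_ * _); rewrite -mulrA -exprD; congr (_ * _ ^+ _); rewrite expnD.
by have := q_gt0 e; have := q_gt0 e'; nia.
Qed.

(** Variables are eliminated from the last one down to the first. Since F involves
    the last one, it cannot divide any of the nonzero polynomials obtained after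
    the first step. *)
Lemma prime_test_element (i0 : 'I_n) (u : B) :
  (forall j : 'I_n, (j <= i0)%N) -> (0 < degree_in i0 F)%N ->
  ~ divides F u -> test_element u.
Proof.
move=> i0max F_i0.
suff main k : (k <= n)%N -> forall w : B, ~ divides F w ->
  (forall j : 'I_n, (k <= j)%N -> degree_in j w = 0%N) -> test_element w.
  by move=> Fu; apply: (main n) => // j; rewrite leqNgt ltn_ord.
elim: k => [_|k IH kn] w Fw wk.
  apply: test_element_const => // [|i]; last exact: wk.
  by apply: contra_notN Fw => /eqP->; exists 0; rewrite mul0r.
have [v [v0 vk] vw] := @test_element_step (Ordinal kn) w Fw wk.
apply: vw; apply: IH => //; first exact: ltnW.
move=> /(degree_in_divides i0 v0).
by rewrite (vk _ (i0max (Ordinal kn))) leqNgt F_i0.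
Qed.

End SquareFree.

(** * The polynomial g y + h *)

Lemma msupp_mwiden (R : comNzRingType) n (f : {mpoly R[n]}) m :
  m \in msupp (mwiden f) -> exists2 m', m' \in msupp f & m = mnmwiden m'.
Proof.
rewrite {1}[f]mpolyE raddf_sum /= => /msupp_sum_le/flattenP[_ /mapP[m' m'f ->]].
rewrite mwidenZ mwidenX => /msuppZ_le; rewrite msuppX inE => /eqP->.
by exists m' => //; move: m'f; rewrite mem_filter.
Qed.

Lemma size_mul_linear (D : idomainType) (u v : {poly D}) :
  size (u * v) = 2%N -> size u = 1%N \/ size v = 1%N.
Proof.
have [->|u0] := eqVneq u 0; first by rewrite mul0r size_poly0.
have [->|v0] := eqVneq v 0; first by rewrite mulr0 size_poly0.
rewrite size_mul //; move: u0 v0; rewrite -!size_poly_gt0; lia.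
Qed.

Section LinearExtension.
Variables (K : fieldType) (n : nat) (g h : {mpoly K[n]}).

Definition linear_extension : {mpoly K[n.+1]} := mwiden g * 'X_ord_max + mwiden h.
Local Notation F := linear_extension.

Lemma linear_extension_sqfree : square_free_supported g ->
  square_free_supported h -> square_free_supported F.
Proof.
move=> gsf hsf.
have wsf (f : {mpoly K[n]}) m i : square_free_supported f ->
    m \in msupp (mwiden f) -> (m i <= (i != ord_max))%N.
  move=> fsf /msupp_mwiden[m' /fsf m'1 ->].
  case: (unliftP ord_max i) => [j ->|->]; last by rewrite mnmwiden_ordmax.
  rewrite eq_sym neq_lift (_ : lift _ j = widen_ord (leqnSn n) j) ?mnmwiden_widen //.
  by apply: val_inj; rewrite /= /bump leqNgt ltn_ord.
move=> m /msuppD_le; rewrite mem_cat => /orP[] mF i; last first.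
  by apply: leq_trans (wsf _ _ i hsf mF) _; case: eqP.
have /allpairsP[[m1 m2] /= [m1g]] := msuppM_le mF.
rewrite msuppX inE => /eqP -> ->; rewrite mnmDE mnm1E eq_sym.
by have := wsf _ _ i gsf m1g; case: eqP; rewrite ?addn0 // => _; lia.
Qed.

Hypotheses (girr : irreducible_element g).
Hypothesis (gndvd : ~ exists q : {mpoly K[n]}, h = q * g).

Let g0 : g != 0. Proof. by case: girr. Qed.
Let h0 : h != 0.
Proof. by apply: contra_notN gndvd => /eqP->; exists 0; rewrite mul0r. Qed.

Lemma muni_linear_extension : muni F = g *: 'X + h%:P.
Proof. by rewrite muniD muniM !muni_widen muni_max mul_polyC. Qed.

Lemma size_muni_linear_extension : size (muni F) = 2%N.
Proof.
rewrite muni_linear_extension size_polyDl ?size_scale ?size_polyX //.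
by rewrite size_polyC h0.
Qed.

Lemma lead_coef_muni_linear_extension : lead_coef (muni F) = g.
Proof.
rewrite lead_coefE size_muni_linear_extension muni_linear_extension /=.
by rewrite coefD coefZ coefX coefC mulr1 addr0.
Qed.

(** F has degree 1 in y, so one of two factors of F is free of y. It divides both g
    and h, hence is a unit or g up to a unit; the latter would make g divide h. *)
Lemma linear_extension_irreducible : irreducible_element F.
Proof.
have muni_inj := can_inj (@muniK K n).
have F0 : F != 0.
  by apply/eqP => e; have := size_muni_linear_extension; rewrite e muni0 size_poly0.
have unitC c : c \is a GRing.unit -> of_uni c%:P \is a GRing.unit.
  by move=> cU; rewrite of_uniC rmorph_unit.
have key (a b : {mpoly K[n.+1]}) :
    F = a * b -> size (muni a) = 1%N -> a \is a GRing.unit.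
  move=> FE sa; have /size_poly1P[c c0 aE] : size (muni a) == 1%N by rewrite sa.
  have [b1 [b0 [gE hE]]] : exists b1 b0, g = c * b1 /\ h = c * b0.
    exists (muni b)`_1, (muni b)`_0.
    rewrite -!coefCM -aE -muniM -FE muni_linear_extension.
    by rewrite !coefD !coefZ !coefX !coefC mulr1 mulr0 add0r addr0.
  case: girr => _ _ /(_ _ _ gE)[cU|b1U].
    by rewrite -[a]muniK aE unitC.
  by case: gndvd; exists (b0 * b1^-1); rewrite gE hE [RHS]mulrCA mulrVK.
split=> //.
  apply/negP; rewrite mpoly_unit_size => /msize_poly1P[c _ FE].
  by have := size_muni_linear_extension; rewrite FE muniC size_polyC; case: eqP.
move=> a b FE; have := size_muni_linear_extension; rewrite FE muniM.
case/size_mul_linear => [sa|sb]; first by left; apply: key FE sa.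
by right; apply: (key b a) => //; rewrite mulrC.
Qed.

Lemma linear_extension_prime : prime_element F.
Proof.
by case: (mpoly_factorial K n.+1) => irrP _; apply/irrP/linear_extension_irreducible.
Qed.

Lemma linear_extension_degree : (0 < degree_in ord_max F)%N.
Proof.
have [m mg] : exists m, m \in msupp g.
  by exists (mlead g); rewrite mlead_supp.
have mF : (mnmwiden m + U_(ord_max))%MM \in msupp F.
  rewrite mcoeff_msupp mcoeffD addmC mcoeffMX mwiden_mnmwiden.
  rewrite (memN_msupp_eq0 (p := mwiden h)) ?addr0 -?mcoeff_msupp //.
  apply/negP => /msupp_mwiden[m' _ /mnmP/(_ ord_max)].
  by rewrite mnmDE !mnmwiden_ordmax mnm1E eqxx.
by apply: leq_trans (degree_in_supp ord_max mF); rewrite mnmDE mnm1E eqxx addn1.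
Qed.

(** The leading coefficient of F in y is g, which is not a unit. *)
Lemma linear_extension_monic (b : {mpoly K[n.+1]}) :
  muni b \is monic -> ~ divides F b.
Proof.
move=> /monicP b1 [w bE]; case: girr => _ gU _; case/negP: gU.
have e : lead_coef (muni w) * g = 1.
  rewrite -b1 bE muniM; apply: esym; apply: etrans (lead_coefM _ _) _.
  by congr (_ * _); apply: lead_coef_muni_linear_extension.
by apply/unitrP; exists (lead_coef (muni w)); rewrite [g * _]mulrC.
Qed.

End LinearExtension.

(** * Homogenization *)

Lemma msize_leP (R : nzRingType) n (f : {mpoly R[n]}) N :
  (forall m, m \in msupp f -> (mdeg m <= N)%N) -> (msize f <= N.+1)%N.
Proof. by move=> fN; apply/bigmax_leqP_seq => m mf _; apply: fN. Qed.

Lemma msizeM_bound (R : nzRingType) n (f g : {mpoly R[n]}) N M :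
  (msize f <= N.+1)%N -> (msize g <= M.+1)%N -> (msize (f * g) <= (N + M).+1)%N.
Proof.
move=> fN gM; apply: msize_leP => m /msuppM_le/allpairsP[[k l] /= [kf lg ->]].
rewrite mdegD leq_add // -ltnS.
  exact: leq_trans (msize_mdeg_lt kf) fN.
exact: leq_trans (msize_mdeg_lt lg) gM.
Qed.

Lemma msizeX_bound (R : nzRingType) n (f : {mpoly R[n]}) N k :
  (msize f <= N.+1)%N -> (msize (f ^+ k) <= (k * N).+1)%N.
Proof.
move=> fN; elim: k => [|k IH]; first by rewrite expr0 msize1.
by rewrite exprS mulSn msizeM_bound.
Qed.

Section Homogenization.
Variables (K : fieldType) (n : nat) (l : {mpoly K[n]}).
Implicit Types (s t : {mpoly K[n]}) (m : 'X_{1..n}).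
Local Notation B := {mpoly K[n.+1]}.

(** The variables y and 'X_i of K[x_1, ..., x_n, y] are replaced by y - l and 'X_i;
    y - l plays the part of the homogenizing variable. *)
Definition homog_var : B := 'X_ord_max - mwiden l.

Local Notation x0 := homog_var.

(** Setting y - l to 1, that is, y to 1 + l. *)
Definition dehomogenize (b : B) : {mpoly K[n]} := (muni b).[1 + l].

(** The form of degree N in the 'X_i and [homog_var] that dehomogenizes to s. It is
    meaningful when N is at least the degree of s; the sum runs over a range that
    does not depend on s so that it is visibly additive. *)
Definition homogenize (N : nat) (s : {mpoly K[n]}) : B :=
  \sum_(m : 'X_{1..n < N.+1}) s@_m *: (x0 ^+ (N - mdeg m) * mwiden 'X_[m]).

Lemma homogenizeD N s t : homogenize N (s + t) = homogenize N s + homogenize N t.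
Proof.
by rewrite -big_split /=; apply: eq_bigr => m _; rewrite mcoeffD scalerDl.
Qed.

Lemma homogenizeZ N c s : homogenize N (c *: s) = c *: homogenize N s.
Proof. by rewrite scaler_sumr; apply: eq_bigr => m _; rewrite mcoeffZ scalerA. Qed.

Lemma homogenize0 N : homogenize N 0 = 0.
Proof. by apply: big1 => m _; rewrite mcoeff0 scale0r. Qed.

Lemma homogenize_sum N (I : eqType) (r : seq I) (f : I -> {mpoly K[n]}) :
  homogenize N (\sum_(i <- r) f i) = \sum_(i <- r) homogenize N (f i).
Proof. exact: (big_morph _ (@homogenizeD N) (@homogenize0 N)). Qed.

Lemma homogenize_monomial N m : (mdeg m <= N)%N ->
  homogenize N 'X_[m] = x0 ^+ (N - mdeg m) * mwiden 'X_[m].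
Proof.
rewrite -ltnS => mN; rewrite /homogenize (bigD1 (BMultinom mN)) //=.
rewrite mcoeffX eqxx scale1r big1 ?addr0 // => m' m'm.
by rewrite mcoeffX -val_eqE eq_sym in m'm *; rewrite (negbTE m'm) scale0r.
Qed.

Lemma homogenizeE N s : (msize s <= N.+1)%N -> homogenize N s =
  \sum_(m <- msupp s) s@_m *: (x0 ^+ (N - mdeg m) * mwiden 'X_[m]).
Proof.
move=> sN; rewrite {1}[s]mpolyE homogenize_sum; apply: eq_big_seq => m ms.
rewrite homogenizeZ homogenize_monomial // -ltnS.
by apply: leq_trans sN; apply: msize_mdeg_lt.
Qed.

Lemma homogenizeM N M s t : (msize s <= N.+1)%N -> (msize t <= M.+1)%N ->
  homogenize (N + M) (s * t) = homogenize N s * homogenize M t.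
Proof.
move=> sN tM; rewrite (homogenizeE sN) (homogenizeE tM).
rewrite {1}[s]mpolyE {1}[t]mpolyE big_distrlr /= homogenize_sum big_distrl /=.
apply: eq_big_seq => m ms; rewrite homogenize_sum big_distrr /=.
apply: eq_big_seq => m' m't.
have mN : (mdeg m <= N)%N.
  by rewrite -ltnS; apply: leq_trans sN; apply: msize_mdeg_lt.
have m'M : (mdeg m' <= M)%N.
  by rewrite -ltnS; apply: leq_trans tM; apply: msize_mdeg_lt.
rewrite -scalerAl -scalerAr scalerA -mpolyXD homogenizeZ.
rewrite homogenize_monomial; last by rewrite mdegD leq_add.
rewrite -scalerAl -scalerAr scalerA mpolyXD mwidenM mdegD.
rewrite (_ : (N + M - _)%N = (N - mdeg m) + (M - mdeg m'))%N; last by lia.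
by rewrite exprD mulrACA.
Qed.

Lemma homogenize1 N : homogenize N 1 = x0 ^+ N.
Proof.
by rewrite -mpolyX0 homogenize_monomial mdeg0 // subn0 mpolyX0 mwiden1 mulr1.
Qed.

Lemma homogenizeX N s k : (msize s <= N.+1)%N ->
  homogenize (k * N) (s ^+ k) = homogenize N s ^+ k.
Proof.
move=> sN; elim: k => [|k IH]; first by rewrite mul0n !expr0 homogenize1.
by rewrite !exprS mulSn homogenizeM ?IH // msizeX_bound.
Qed.

Lemma homogenize_homog d s : s \is d.-homog -> homogenize d s = mwiden s.
Proof.
move=> /dhomogP sd; rewrite homogenizeE; last by apply: msize_leP => m /sd->.
rewrite [in RHS](mpolyE s) raddf_sum /=; apply: eq_big_seq => m /sd->.
by rewrite subnn expr0 mul1r mwidenZ.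
Qed.

Lemma dehomogenizeM : {morph dehomogenize : b c / b * c}.
Proof. by move=> b c; rewrite /dehomogenize muniM hornerM. Qed.

Lemma dehomogenizeD : {morph dehomogenize : b c / b + c}.
Proof. by move=> b c; rewrite /dehomogenize muniD hornerD. Qed.

Lemma dehomogenize_widen s : dehomogenize (mwiden s) = s.
Proof. by rewrite /dehomogenize muni_widen hornerC. Qed.

Lemma dehomogenize_var : dehomogenize x0 = 1.
Proof.
rewrite /dehomogenize muniB muni_max muni_widen hornerD hornerN hornerX hornerC.
by rewrite addrK.
Qed.

Lemma dehomogenize_varX k : dehomogenize (x0 ^+ k) = 1.
Proof.
elim: k => [|k IH]; last by rewrite exprS dehomogenizeM IH dehomogenize_var mul1r.
by rewrite expr0 -mwiden1 dehomogenize_widen.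
Qed.

Lemma homogenizeK N s : (msize s <= N.+1)%N -> dehomogenize (homogenize N s) = s.
Proof.
move=> sN; rewrite (homogenizeE sN) [RHS]mpolyE.
have d0 : dehomogenize 0 = 0 by rewrite /dehomogenize muni0 horner0.
rewrite (big_morph _ dehomogenizeD d0); apply: eq_bigr => m _.
rewrite -mul_mpolyC dehomogenizeM -mwidenC dehomogenize_widen mul_mpolyC.
congr (_ *: _); rewrite dehomogenizeM dehomogenize_widen.
by rewrite dehomogenize_varX mul1r.
Qed.

End Homogenization.

(** * The hypersurface ring *)

Definition frobenius_power_mod (R : comPzRingType) (f : R) (J : set R) (q : nat) :
    set R :=
  generated_ideal ([set x ^+ q | x in J] `|` [set f])%classic.

Section Hypersurface.
Variables (K : fieldType) (n d : nat) (g h l : {mpoly K[n]}).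
Hypotheses (ghom : g \is d.-homog) (hhom : h \is d.+1.-homog) (lhom : l \is 1.-homog).
Hypotheses (girr : irreducible_element g).
Hypothesis (gndvd : ~ exists q : {mpoly K[n]}, h = q * g).

Let f := g * (1 + l) + h.
Local Notation F := (linear_extension g h).
Local Notation homogenize := (homogenize l).
Local Notation dehomogenize := (dehomogenize l).
Local Notation x0 := (homog_var l).

Let msize_1l : (msize (1 + l) <= 2)%N.
Proof.
apply: msize_leP => m /msuppD_le; rewrite msupp1 mem_cat inE.
by case/orP=> [/eqP->|/(dhomog_mf lhom) ->]; rewrite ?mdeg0.
Qed.

Let msize_g : (msize g <= d.+1)%N.
Proof. by apply: msize_leP => m /(dhomog_mf ghom) ->. Qed.

Let msize_f : (msize f <= d.+2)%N.
Proof.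
apply: leq_trans (mmeasureD_le _ _ _) _; rewrite geq_max -{1}[d.+1]addn1.
by rewrite msizeM_bound //; apply: msize_leP => m /(dhomog_mf hhom) ->.
Qed.

Lemma homogenize_hypersurface N : homogenize (N + d.+1) f = x0 ^+ N * F.
Proof.
rewrite -[f]mul1r homogenizeM ?msize1 // homogenize1; congr (_ * _).
rewrite homogenizeD (homogenize_homog _ hhom) -{1}[d.+1]addn1 homogenizeM //.
rewrite (homogenize_homog _ ghom) homogenizeD homogenize1 (homogenize_homog _ lhom).
by rewrite expr1 subrK.
Qed.

Lemma dehomogenize_linear_extension : dehomogenize F = f.
Proof.
rewrite dehomogenizeD dehomogenizeM !dehomogenize_widen.
by rewrite /dehomogenize muni_max hornerX.
Qed.

Lemma divides_dehomogenize N s : (msize s <= N.+1)%N ->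
  divides F (homogenize N s) -> divides f s.
Proof.
move=> sN [k e]; exists (dehomogenize k).
by rewrite -(homogenizeK l sN) e dehomogenizeM dehomogenize_linear_extension.
Qed.

Lemma homogenize_divides N s : divides f s ->
  exists2 M, (N <= M)%N & divides F (homogenize M s).
Proof.
move=> [k ->]; exists (msize k + (N + d.+1))%N; first by lia.
exists (homogenize (msize k) k * x0 ^+ N).
rewrite homogenizeM; [|exact: leqnSn|by lia].
by rewrite homogenize_hypersurface mulrA.
Qed.

(** Homogenizing 1 gives a power of y - l, which is monic in y. *)
Lemma hypersurface_nonunit : ~ divides f 1.
Proof.
move=> /(homogenize_divides 0)[M _]; rewrite homogenize1.
apply: (linear_extension_monic girr gndvd).
have -> : muni (x0 ^+ M) = ('X - l%:P) ^+ M.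
  elim: M => [|M IH]; first by rewrite !expr0 muni1.
  by rewrite !exprS muniM IH muniB muni_max muni_widen.
by rewrite monic_exp // monicXsubC.
Qed.

Lemma hypersurface_prime s t : divides f (s * t) -> divides f s \/ divides f t.
Proof.
have [_ _ Fdiv] := linear_extension_prime girr gndvd.
move=> /(homogenize_divides (msize s + msize t))[M leM].
have -> : M = (msize s + (M - msize s))%N by lia.
have tM : (msize t <= (M - msize s).+1)%N by lia.
rewrite homogenizeM //; case/Fdiv => /divides_dehomogenize div.
  by left; apply: div.
by right; apply: div.
Qed.

(** Let J' be the preimage of J. If s is the sum of the a_k (j_k)^q and b f with
    j_k in J, then in high degrees the homogenization of s is a combination of the
    q-th powers of those of the j_k, which lie in J', and of F. As F is also in J',
    multiplication by F^(q-1) turns this into an element of J'^[q]. *)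
Lemma homogenize_frobenius_power_mod (J : set {mpoly K[n]}) (q : nat) s :
  ideal J -> J f -> (0 < q)%N -> frobenius_power_mod f J q s ->
  exists N0, forall N, (N0 <= N)%N ->
    frobenius_power [set b | J (dehomogenize b)]%classic q
      (homogenize N s * F ^+ q.-1).
Proof.
move=> idJ Jf q0; set J' := [set b | _]%classic.
set L := frobenius_power J' q; have idL : ideal L by apply: generated_idealP.
pose Q := [set s | exists N0, forall N, (N0 <= N)%N ->
  L (homogenize N s * F ^+ q.-1)]%classic.
suff sub : forall x, frobenius_power_mod f J q x -> Q x by apply: sub.
apply: generated_ideal_sub => [|x []].
- split=> [|x y /= [N Lx] [M Ly]|a x /= [N Lx]].
  + by exists 0%N => N _; rewrite homogenize0 mul0r; apply: ideal0 idL.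
  + exists (N + M)%N => k kNM; rewrite homogenizeD mulrDl.
    by apply: (idealD idL); [apply: Lx|apply: Ly]; lia.
  + exists (msize a + (N + msize x))%N => k ka.
    have -> : k = (msize a + (k - msize a))%N by lia.
    have kx : (msize x <= (k - msize a).+1)%N by lia.
    rewrite homogenizeM // -mulrA; apply: (idealMl _ idL); apply: Lx; lia.
- move=> [j Jj <-]; exists (q * msize j)%N => N Nj.
  have -> : N = (q * msize j + (N - q * msize j))%N by lia.
  rewrite -[j ^+ q]mulr1 homogenizeM ?msize1 ?msizeX_bound // homogenizeX //.
  rewrite -mulrA mulrC; apply: (idealMl _ idL); apply: sub_generated_ideal.
  by exists (homogenize (msize j) j) => //; rewrite /J' /= homogenizeK.
move=> ->; exists d.+1 => N dN; rewrite -(subnK dN) homogenize_hypersurface.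
rewrite -mulrA -exprS prednK //; apply: (idealMl _ idL).
apply: sub_generated_ideal; exists F => //.
by rewrite /J' /= dehomogenize_linear_extension.
Qed.

Variable p : nat.
Hypotheses (pK : p \in [pchar K]).
Hypotheses (gsf : square_free_supported g) (hsf : square_free_supported h).

(** The exponent e is obtained from the homogenization of c alone, before r enters;
    the degree M in which r is homogenized may depend on e. *)
Lemma hypersurface_tight (J : set {mpoly K[n]}) (c r : {mpoly K[n]}) e0 :
  ideal J -> J f -> ~ divides f c ->
  (forall e, (e0 <= e)%N -> frobenius_power_mod f J (p ^ e) (c * r ^+ (p ^ e))) -> J r.
Proof.
move=> idJ Jf fc tc.
have Fc : ~ divides F (homogenize (msize c) c).
  by move/divides_dehomogenize => div; apply: fc; apply: div.
have i0max (j : 'I_n.+1) : (j <= (ord_max : 'I_n.+1))%N by rewrite -ltnS.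
have [e e0e test] := prime_test_element pK (linear_extension_sqfree gsf hsf)
  (linear_extension_prime girr gndvd) i0max (linear_extension_degree h girr) Fc e0.
set q := (p ^ e)%N in test; have q0 : (0 < q)%N.
  by rewrite expn_gt0 prime_gt0 // (pcharf_prime pK).
have [N0 Lr] := homogenize_frobenius_power_mod idJ Jf q0 (tc e e0e).
pose M := (msize r + N0)%N.
have Mr : (msize r <= M.+1)%N by rewrite /M; lia.
rewrite -(homogenizeK l Mr).
apply: (test [set b | J (dehomogenize b)]%classic).
  split=> [|b b'|b b'] /=; rewrite ?dehomogenizeD ?dehomogenizeM.
  - by rewrite /dehomogenize muni0 horner0; apply: ideal0 idJ.
  - exact: idealD idJ.
  - exact: idealMl idJ.
have := Lr (msize c + q * M)%N; rewrite homogenizeM ?msizeX_bound //.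
rewrite homogenizeX // mulrAC; apply.
by rewrite /M; nia.
Qed.

End Hypersurface.

Local Open Scope quotient_scope.

Section QuotientMap.
Variables (S : comPzRingType) (f : S).

Definition quotient_map (s : S) : quotient_by f :=
  \pi_(quotient (generated_idealP [set f]%classic)) s.

Lemma quotient_mapD s t : quotient_map (s + t) = quotient_map s + quotient_map t.
Proof. exact: esym (pi_quotient_add _ _ _). Qed.

Lemma quotient_mapM s t : quotient_map (s * t) = quotient_map s * quotient_map t.
Proof. exact: esym (pi_quotient_mul _ _ _). Qed.

Lemma quotient_map1 : quotient_map 1 = 1.
Proof. by []. Qed.

Lemma quotient_map_surj x : exists s, quotient_map s = x.
Proof. by exists (repr x); rewrite /quotient_map reprK. Qed.

Lemma quotient_map_eq s t : quotient_map s = quotient_map t <-> divides f (s - t).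
Proof.
split=> [/quotient_eqP|st].
  by rewrite ideal_predE => /asboolP/generated_ideal1P.
by apply/quotient_eqP; rewrite ideal_predE; apply/asboolP/generated_ideal1P.
Qed.

Lemma quotient_map0 : quotient_map 0 = 0.
Proof. by apply: (addrI (quotient_map 0)); rewrite -quotient_mapD !addr0. Qed.

Lemma quotient_mapX s k : quotient_map (s ^+ k) = quotient_map s ^+ k.
Proof.
elim: k => [|k IH]; first by rewrite !expr0 quotient_map1.
by rewrite !exprS quotient_mapM IH.
Qed.

Lemma quotient_map_nat k : quotient_map k%:R = k%:R.
Proof.
elim: k => [|k IH]; first exact: quotient_map0.
by rewrite -addn1 !natrD quotient_mapD IH quotient_map1.
Qed.

Lemma quotient_map_eq0 s : quotient_map s = 0 <-> divides f s.
Proof. by rewrite -quotient_map0 quotient_map_eq subr0. Qed.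

End QuotientMap.

Lemma lift_frobenius_power (S : comPzRingType) (f : S) (I : set (quotient_by f))
    q s : ideal I -> frobenius_power I q (quotient_map f s) ->
  frobenius_power_mod f [set t | I (quotient_map f t)]%classic q s.
Proof.
move=> idI; rewrite /frobenius_power_mod.
set L := generated_ideal _; have idL : ideal L by apply: generated_idealP.
have Lf t : divides f t -> L t.
  by case=> k ->; apply: (idealMl _ idL); apply: sub_generated_ideal; right.
have Llift t u : quotient_map f t = quotient_map f u -> L u -> L t.
  move=> /quotient_map_eq /Lf Ltu Lu; rewrite -(subrK u t); exact: (idealD idL).
pose Q := [set x | forall t, quotient_map f t = x -> L t]%classic.
suff sub : forall x, frobenius_power I q x -> Q x by move=> /sub; apply.
apply: generated_ideal_sub => [|_ [x Ix <-] t].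
- split=> [t /quotient_map_eq0/Lf //|x y Lx Ly t|a x Lx t].
  + have [u ux] := quotient_map_surj x; have [v vy] := quotient_map_surj y.
    rewrite -ux -vy -quotient_mapD => /Llift; apply.
    by apply: (idealD idL); [apply: Lx|apply: Ly].
  + have [u ux] := quotient_map_surj x; have [b ba] := quotient_map_surj a.
    rewrite -ux -ba -quotient_mapM => /Llift; apply.
    by apply: (idealMl _ idL); apply: Lx.
have [u ux] := quotient_map_surj x; rewrite -ux -quotient_mapX => /Llift; apply.
by apply: sub_generated_ideal; left; exists u => //; rewrite /= ux.
Qed.

Theorem theorem3 (K : fieldType) (p : nat) (hp : p \in [pchar K]) (n d : nat)
    (g h : {mpoly K[n]})
    (gsf : square_free_supported g) (hsf : square_free_supported h)
    (ghom : g \is d.-homog) (hhom : h \is d.+1.-homog)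
    (girr : irreducible_element g)
    (gndvd : ~ exists q : {mpoly K[n]}, h = q * g)
    (a : 'I_n -> K) :
  F_rational (quotient_by (g * (1 + \sum_(i < n) a i *: 'X_i) + h)).
Proof.
set l := \sum_(i < n) _; set f := g * (1 + l) + h.
have lhom : l \is 1.-homog.
  apply: rpred_sum => i _; apply: dhomogZ; rewrite dhomogX.
  by apply/eqP; apply: mdeg1.
have fnu := hypersurface_nonunit ghom hhom lhom girr gndvd.
have fprime := hypersurface_prime ghom hhom lhom girr gndvd.
split.
  apply: (@noetherian_surj {mpoly K[n]} _ (quotient_map f)).
  - exact: quotient_mapD.
  - exact: quotient_mapM.
  - exact: quotient_map_surj.
  - exact: mpoly_noetherian.
have p_prime := pcharf_prime hp.
exists p.
  split=> // k; rewrite -quotient_map_nat quotient_map_eq0 (dvdn_pcharf hp).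
  split; last first.
    by move=> /eqP k0; exists 0; rewrite mul0r -mpolyC_nat k0.
  move=> [w e]; apply/eqP; apply: contrapT => /eqP k0; apply: fnu.
  exists ((k%:R)^-1 *: w); rewrite -scalerAl -e -mpolyC_nat -mul_mpolyC -mpolyCM.
  by rewrite mulVf // mpolyC1.
move=> I [r [IE _]].
have idI : ideal I by rewrite IE; apply: generated_idealP.
apply/seteqP; split=> x.
  move=> Ix; exists 1; split; first by move=> P [[]].
  by exists 0%N => e _; rewrite mul1r; apply: sub_generated_ideal; exists x.
case=> c [cmin [e0 tc]].
have [c' cE] := quotient_map_surj c; have [x' xE] := quotient_map_surj x.
(* The zero ideal is prime, hence minimal, and c lies outside it. *)
have fc : ~ divides f c'.
  move=> /quotient_map_eq0; rewrite cE => c0; apply: (cmin [set 0]%classic); last by [].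
  split; first split.
  - split=> [|y z -> ->|b y ->] //=; rewrite ?addr0 ?mulr0 //.
  - by rewrite /= -quotient_map1 => /quotient_map_eq0.
  - move=> y z; have [y' <-] := quotient_map_surj y.
    have [z' <-] := quotient_map_surj z; rewrite /= -quotient_mapM.
    by move=> /quotient_map_eq0/fprime[]/quotient_map_eq0; [left|right].
  move=> Q [idQ _ _] Q0; apply/seteqP; split=> // _ ->; exact: ideal0 idQ.
pose J : set {mpoly K[n]} := [set t | I (quotient_map f t)]%classic.
rewrite -xE -/(J x').
have tight := hypersurface_tight ghom hhom lhom girr gndvd hp gsf hsf.
apply: (tight J c' x' e0) => //.
- split=> [|s t|s t]; rewrite /J /= ?quotient_map0 ?quotient_mapD ?quotient_mapM.
  + exact: ideal0 idI.
  + exact: idealD idI.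
  + exact: idealMl idI.
- rewrite /J /= (_ : quotient_map f f = 0); first exact: ideal0 idI.
  by apply/quotient_map_eq0; exists 1; rewrite mul1r.
move=> e ee0; apply: lift_frobenius_power => //.
by rewrite quotient_mapM quotient_mapX cE xE; apply: tc.
Qed.
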